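(* There exists an absolute constant $c>0$ such that for every positive integer $n$, \[\operatorname{herdisc}(\mathcal A_n)\le c\,\phi(n)^{1/2}\left(\log\frac{en}{\phi(n)}\right)^{3/2}.\]
   Context: An arithmetic progression in $\mathbb{Z}_n$ is a set $\{a+kd: 0\le k<l\}$ with $a,d\in\mathbb{Z}_n$ and $l$ an integer with $0\le l\le n/\gcd(n,d)$ (with $\gcd(0,n)=n$); $\mathcal A_n$ is the family of all of them. For $X\subseteq\mathbb{Z}_n$ and $\chi:X\to\{1,-1\}$, $\chi(B)=\sum_{x\in B}\chi(x)$ for $B\subseteq X$; $\operatorname{disc}(\mathcal A_n|_X)=\min_{\chi:X\to\{1,-1\}}\max_{A\in\mathcal A_n}|\chi(A\cap X)|$, and $\operatorname{herdisc}(\mathcal A_n)=\max_{X\subseteq\mathbb{Z}_n}\operatorname{disc}(\mathcal A_n|_X)$. $\phi$ is Euler's totient function; logarithms are natural. *)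

(* Defs.v *)
From mathcomp Require Import all_boot all_order ssralg ssrint.
From Stdlib Require Import Reals.
Set Implicit Arguments. Unset Strict Implicit. Unset Printing Implicit Defensive.
Import GRing.Theory.

(* Z_n is represented by 'I_n (residues 0..n-1, arithmetic mod n); this works
   uniformly for every n >= 1, including n = 1. *)

Definition ap (n : nat) (a d l : nat) : {set 'I_n} :=
  [set x : 'I_n | [exists k : 'I_l, nat_of_ord x == (a + k * d) %% n]].

(* Admissible parameters: a, d in Z_n, 0 <= l <= n / gcd(n,d)
   (note gcdn n 0 = n, matching gcd(0,n) = n).  Since n / gcd(n,d) <= n,
   l ranges over 'I_n.+1. *)
Definition ap_ok (n : nat) (d : 'I_n) (l : 'I_n.+1) : bool :=
  (nat_of_ord l <= n %/ gcdn n d)%N.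

(* chi(B cap X) for a colouring chi : Z_n -> {1,-1} (true = +1, false = -1);
   only the values on X matter. *)
Definition col_sum (n : nat) (X B : {set 'I_n}) (chi : {ffun 'I_n -> bool}) : int :=
  \sum_(x in B :&: X) (if chi x then Posz 1 else Negz 0).

Definition max_dev (n : nat) (X : {set 'I_n}) (chi : {ffun 'I_n -> bool}) : nat :=
  \max_(a : 'I_n) \max_(d : 'I_n) \max_(l : 'I_n.+1 | ap_ok d l)
     absz (col_sum X (ap n a d l) chi).

Definition disc_AP (n : nat) (X : {set 'I_n}) : nat :=
  max_dev X [arg min_(chi < [ffun=> true] : {ffun 'I_n -> bool}) max_dev X chi].

Definition herdisc_AP (n : nat) : nat := \max_(X : {set 'I_n}) disc_AP X.

(* Main.v *)
Require Import Defs.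
From mathcomp Require Import all_boot all_order all_algebra archimedean.
From mathcomp Require Import zify ring lra reals sequences exp.

(** The bound comes from the partial colouring method with chaining.

    For each difference [d], list [Z_n] coset by coset of the subgroup generated
    by [d]; an arithmetic progression with difference [d] is then a union of at
    most two intervals of length at most the order [n / gcd (n, d)] of [d].
    Restrict the list to the set [X] of points still uncoloured and cut it into
    dyadic blocks; only blocks of length [2 ^ j <= n / gcd (n, d)] are needed, so
    there are at most [D_j * #|X| / 2 ^ j] blocks of length [2 ^ j], with [D_j] the
    number of [d] of order at least [2 ^ j].  Since
    [phi (n / g) <= phi (n) / phi (g)] and the sum of [1 / phi (g)] over [g <= G] is
    [O (1 + log G)], [D_j = O (phi (n) (1 + log (n / 2 ^ j)))].

    With [2 ^ J] of order [phi (n) log (e n / phi (n))], a partial colouring gives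
    blocks of length [2 ^ j] a discrepancy which decays geometrically as [j] moves
    away from [J] in either direction, so that every progression has discrepancy
    [O (2 ^ (J / 2))].  Iterating, a constant number of rounds halves [X]: the
    rounds with [#|X| >= 2 ^ J] contribute [O (2 ^ (J / 2) log (e n / phi (n)))], and
    those with [#|X| < 2 ^ J] a geometric series. *)

Set Implicit Arguments. Unset Strict Implicit. Unset Printing Implicit Defensive.
Import Order.TTheory GRing.Theory Num.Theory.
Local Open Scope ring_scope.

(** * Moments of random signed sums *)

Definition symdiff (T : finType) (A B : {set T}) : {set T} :=
  (A :\: B) :|: (B :\: A).

Lemma in_symdiff (T : finType) (A B : {set T}) x :
  (x \in symdiff A B) = (x \in A) (+) (x \in B).
Proof. by rewrite !inE; do 2!case: (x \in _). Qed.

Lemma symdiffK (T : finType) (B : {set T}) : involutive (fun A => symdiff A B).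
Proof. by move=> A; apply/setP=> x; rewrite !in_symdiff; do 2!case: (x \in _). Qed.

Lemma sub_symdiff (T : finType) (X A B : {set T}) :
  B \subset X -> (symdiff A B \subset X) = (A \subset X).
Proof.
move=> sBX; apply/idP/idP => [/subsetP s|/subsetP s]; apply/subsetP=> x.
  case: (boolP (x \in B)) => [/(subsetP sBX)//|xB xA].
  by apply: s; rewrite in_symdiff xA (negbTE xB).
rewrite in_symdiff; case: (boolP (x \in B)) => [/(subsetP sBX)//|_].
by rewrite addbF; exact: s.
Qed.

Lemma sum_powerset_symdiff (V : nmodType) (T : finType) (X B : {set T})
    (F : {set T} -> V) : B \subset X ->
  \sum_(C in powerset X) F C = \sum_(C in powerset X) F (symdiff C B).
Proof.
move=> sBX; rewrite (reindex_inj (can_inj (symdiffK B))) /=.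
by apply: eq_bigl => C; rewrite !powersetE sub_symdiff.
Qed.

Section Signs.
Variables (R : realType) (T : finType).
Implicit Types (C S X : {set T}).

Definition sgn C (x : T) : R := if x \in C then 1 else -1.

Definition sgnsum C S : R := \sum_(x in S) sgn C x.

Lemma sgnsumU1 C S x : x \notin S -> sgnsum C (x |: S) = sgn C x + sgnsum C S.
Proof. by move=> xS; rewrite /sgnsum big_setU1. Qed.

(* Flipping the colour of [x] permutes [powerset X] and preserves [sgnsum C S]. *)
Lemma sum_sgnsum_flip (f : R -> R) X S x : S \subset X -> x \in X -> x \notin S ->
  \sum_(C in powerset X) f (sgnsum C (x |: S)) =
  \sum_(C in powerset X) ((f (sgnsum C S + 1) + f (sgnsum C S - 1)) / 2).
Proof.
move=> sSX xX xS.
have E : \sum_(C in powerset X) f (sgnsum C (x |: S)) =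
         \sum_(C in powerset X) f (sgnsum C S - sgn C x).
  rewrite (@sum_powerset_symdiff _ _ X [set x]) ?sub1set //.
  apply: eq_bigr => C _; rewrite sgnsumU1 //; congr f; rewrite addrC; congr (_ + _).
    apply: eq_bigr => y yS; rewrite /sgn in_symdiff inE.
    by case: eqP yS => [->|_ _]; rewrite ?(negbTE xS) // addbF.
  by rewrite /sgn in_symdiff inE eqxx addbT; case: (x \in C); rewrite ?opprK.
transitivity ((\sum_(C in powerset X) f (sgnsum C (x |: S)) +
   \sum_(C in powerset X) f (sgnsum C S - sgn C x)) / 2).
  by rewrite -E; lra.
rewrite -big_split /= mulr_suml; apply: eq_bigr => C _.
rewrite sgnsumU1 // /sgn; case: (x \in C); rewrite ?opprK addrC //.
  by rewrite addrC [1 + _]addrC.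
by rewrite [- 1 + _]addrC.
Qed.

(** Averaging over the sign of one point keeps only the even part of [(s + 1) ^+ p], so the moments
    obey binomial recurrences. The constants 3, 15 and 105 are the Gaussian ones, and the bounds are
    stable under these recurrences. *)
Lemma sgnsum_moments X S : S \subset X ->
  [/\ \sum_(C in powerset X) sgnsum C S ^+ 2 = #|S|%:R * 2 ^+ #|X|,
      \sum_(C in powerset X) sgnsum C S ^+ 4 <= 3 * #|S|%:R ^+ 2 * 2 ^+ #|X|,
      \sum_(C in powerset X) sgnsum C S ^+ 6 <= 15 * #|S|%:R ^+ 3 * 2 ^+ #|X| &
      \sum_(C in powerset X) sgnsum C S ^+ 8 <= 105 * #|S|%:R ^+ 4 * 2 ^+ #|X|].
Proof.
have [k] := ubnP #|S|; elim: k S => // k IH S ltSk sSX.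
have cX : \sum_(C in powerset X) (1 : R) = 2 ^+ #|X|.
  by rewrite sumr_const card_powerset natrX.
case: (set_0Vmem S) => [->|[x xS]].
  have z p : \sum_(C in powerset X) sgnsum C set0 ^+ p.+1 = 0.
    by apply: big1 => C _; rewrite /sgnsum big_set0 expr0n.
  by rewrite !z cards0; split; rewrite ?mul0r // expr0n /= mulr0 mul0r.
have xX := subsetP sSX x xS.
have sS'X : S :\ x \subset X by apply: subset_trans sSX; exact: subD1set.
have xS' : x \notin S :\ x by rewrite !inE eqxx.
have cS : #|S| = #|S :\ x|.+1 by rewrite (cardsD1 x S) xS.
have ltS' : (#|S :\ x| < k)%N by rewrite cS in ltSk.
have {IH} := IH _ ltS' sS'X.
have flip p : \sum_(C in powerset X) sgnsum C S ^+ p = \sum_(C in powerset X)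
    (((sgnsum C (S :\ x) + 1) ^+ p + (sgnsum C (S :\ x) - 1) ^+ p) / 2).
  by rewrite -(sum_sgnsum_flip (fun y => y ^+ p) sS'X xX xS') setD1K.
have -> : #|S|%:R = #|S :\ x|%:R + 1 :> R by rewrite cS natr1.
rewrite !{}flip.
set N : R := 2 ^+ _ in cX *; set s : R := #|_|%:R.
have s0 : 0 <= s by rewrite ler0n.
have N0 : 0 <= N by rewrite exprn_ge0 ?ler0n.
set M2 := \sum_(C in _) sgnsum _ _ ^+ 2; set M4 := \sum_(C in _) sgnsum _ _ ^+ 4.
set M6 := \sum_(C in _) sgnsum _ _ ^+ 6; set M8 := \sum_(C in _) sgnsum _ _ ^+ 8.
move=> [e2 l4 l6 l8].
have -> : \sum_(C in powerset X) (((sgnsum C (S :\ x) + 1) ^+ 2 +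
  (sgnsum C (S :\ x) - 1) ^+ 2) / 2) = M2 + N.
  by rewrite -cX -big_split /=; apply: eq_bigr => C _; field.
have -> : \sum_(C in powerset X) (((sgnsum C (S :\ x) + 1) ^+ 4 +
  (sgnsum C (S :\ x) - 1) ^+ 4) / 2) = M4 + 6 * M2 + N.
  by rewrite -cX mulr_sumr -!big_split /=; apply: eq_bigr => C _; field.
have -> : \sum_(C in powerset X) (((sgnsum C (S :\ x) + 1) ^+ 6 +
  (sgnsum C (S :\ x) - 1) ^+ 6) / 2) = M6 + 15 * M4 + 15 * M2 + N.
  by rewrite -cX !mulr_sumr -!big_split /=; apply: eq_bigr => C _; field.
have -> : \sum_(C in powerset X) (((sgnsum C (S :\ x) + 1) ^+ 8 +
  (sgnsum C (S :\ x) - 1) ^+ 8) / 2) = M8 + 28 * M6 + 70 * M4 + 28 * M2 + N.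
  by rewrite -cX !mulr_sumr -!big_split /=; apply: eq_bigr => C _; field.
have h1 : 0 <= s * N by rewrite mulr_ge0.
have h2 : 0 <= s ^+ 2 * N by rewrite mulr_ge0 // exprn_ge0.
have h3 : 0 <= s ^+ 3 * N by rewrite mulr_ge0 // exprn_ge0.
rewrite e2; split; first by ring.
- have -> : 3 * (s + 1) ^+ 2 * N = 3 * s ^+ 2 * N + 6 * (s * N) + 3 * N by ring.
  lra.
- have -> : 15 * (s + 1) ^+ 3 * N = 15 * s ^+ 3 * N + 45 * (s ^+ 2 * N) +
    45 * (s * N) + 15 * N by ring.
  lra.
- have -> : 105 * (s + 1) ^+ 4 * N = 105 * s ^+ 4 * N + 420 * (s ^+ 3 * N) +
    630 * (s ^+ 2 * N) + 420 * (s * N) + 105 * N by ring.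
  lra.
Qed.

Lemma sum_powerset_expr (z : R) X :
  \sum_(S in powerset X) z ^+ #|S| = (1 + z) ^+ #|X|.
Proof.
have [k] := ubnP #|X|; elim: k X => // k IH X ltXk.
case: (set_0Vmem X) => [->|[x xX]].
  by rewrite powerset0 big_set1 !cards0 !expr0.
have cX : #|X| = #|X :\ x|.+1 by rewrite (cardsD1 x X) xX.
have {IH} IH := IH (X :\ x); rewrite cX in ltXk *.
rewrite exprS -IH // mulrDl mul1r mulr_sumr.
rewrite (bigID (fun S : {set T} => x \in S)) /= addrC; congr (_ + _).
  apply: eq_bigl => S; rewrite !powersetE subsetD1 //.
rewrite (reindex_onto (fun S => x |: S) (fun S => S :\ x)) /=; last first.
  by move=> S /andP[_ xS]; rewrite setD1K.
apply: eq_big => [S|S].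
  rewrite !powersetE subUset sub1set xX /= setU11 andbT subsetD1.
  congr (_ && _); apply/eqP/idP => [<-|xS]; first by rewrite !inE eqxx.
  by rewrite setU1K.
move=> /andP[_ /eqP e]; have xS : x \notin S by rewrite -e setD11.
by rewrite cardsU1 xS exprS.
Qed.

End Signs.

(** * Partial colouring *)

(* The entropy method, phrased with codes: [c i k] is the length of a code word
   for the event that [sgnsum C (S i)] has absolute value in
   [[k * D i, (k + 1) * D i)].  If the average total code length is at most
   [#|X| / 16], then two colourings that differ at more than [#|X| / 4] points
   share all code words, and half their difference is the partial colouring. *)
Section PartialColouring.
Variables (R : realType) (T I : finType) (A : pred I) (X : {set T}).
Variables (S : I -> {set T}) (D : I -> R) (c : I -> nat -> R).

Definition bucket i C : nat := Num.truncn (`|sgnsum R C (S i)| / D i).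

Hypothesis D_gt0 : forall i, A i -> 0 < D i.
(* The factor [2] accounts for the sign. *)
Hypothesis kraft : forall i M, A i ->
  expR (- c i 0%N) + 2 * \sum_(k < M) expR (- c i k.+1) <= 1.
Hypothesis budget :
  \sum_(i | A i) \sum_(C in powerset X) c i (bucket i C)
    <= #|X|%:R / 16 * 2 ^+ #|X|.

(** A nonzero bucket together with the sign confines the sum to an interval of length [D i]; in
    bucket zero no sign is recorded and the sum only lies within [D i] of 0. The factor 2 disappears
    when the difference of two colourings is halved. *)
Lemma bucket_close i C C' : A i -> bucket i C = bucket i C' ->
  ((0 < bucket i C)%N && (0 < sgnsum R C (S i))) =
  ((0 < bucket i C')%N && (0 < sgnsum R C' (S i))) ->
  `|sgnsum R C (S i) - sgnsum R C' (S i)| <= 2 * D i.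
Proof.
move=> Ai; rewrite /bucket; have D0 := D_gt0 Ai.
set x := sgnsum R C _; set y := sgnsum R C' _ => e.
have b (z : R) : (Num.truncn (`|z| / D i))%:R * D i <= `|z|
    < ((Num.truncn (`|z| / D i))%:R + 1) * D i.
  rewrite natr1 -ler_pdivlMr // -ltr_pdivrMr //; apply: truncn_itv.
  by rewrite divr_ge0 // ltW.
have := b x; have := b y; rewrite -{}e; set k := Num.truncn _.
case: (posnP k) => [->|k0] /= /andP[y1 y2] /andP[x1 x2] s.
  by apply: le_trans (ler_normB _ _) _; lra.
have kD : 0 < k%:R * D i by rewrite mulr_gt0 ?ltr0n.
have [x0|x0] := ltrP 0 x; have [y0|y0] := ltrP 0 y; move: s; rewrite ?x0 ?y0.
- move=> _; move: x1 x2 y1 y2; rewrite (gtr0_norm x0) (gtr0_norm y0) mulrDl mul1r => *.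
  by rewrite ler_norml; apply/andP; split; lra.
- by rewrite ltNge y0.
- by rewrite ltNge x0.
- move=> _; move: x1 x2 y1 y2; rewrite (ler0_norm x0) (ler0_norm y0) mulrDl mul1r => *.
  by rewrite ler_norml; apply/andP; split; lra.
Qed.

(** A common bound on the buckets makes the keys range over a finite type. *)
Let M := \max_(i : I) \max_(C : {set T}) bucket i C.
(** The sign is dropped in bucket zero, which [kraft] counts only once. *)
Let key i C : bool * 'I_M.+1 :=
  ((0 < bucket i C)%N && (0 < sgnsum R C (S i)), inord (bucket i C)).
(** Default key off [A], so that the keys of a colouring form a member of a [pfamily]. *)
Let j0 : bool * 'I_M.+1 := (false, ord0).
Let keyf C : {ffun I -> bool * 'I_M.+1} :=
  [ffun i => if A i then key i C else j0].
(** A subprobability on keys, by [kraft]; the pair [(true, 0)] never occurs as a key and gets weight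
    0. *)
Let Q i (j : bool * 'I_M.+1) : R :=
  if (j.2 == 0 :> nat) then (if j.1 then 0 else expR (- c i 0%N))
  else expR (- c i j.2).

Let bucket_le i C : (bucket i C <= M)%N.
Proof.
apply: leq_trans (leq_bigmax (F := fun i => \max_(C : {set T}) bucket i C) i).
exact: (leq_bigmax (F := bucket i)).
Qed.

Let Q_key i C : Q i (key i C) = expR (- c i (bucket i C)).
Proof.
rewrite /Q /key /= inordK ?ltnS ?bucket_le //.
by case: eqP => // ->.
Qed.

Let Q_ge0 i j : 0 <= Q i j.
Proof. by rewrite /Q; do !case: ifP => // _; rewrite ?expR_ge0. Qed.

Let sum_Q i : A i -> \sum_j Q i j <= 1.
Proof.
move=> Ai; rewrite -(pair_bigA _ (fun b k => Q i (b, k))) /= big_bool /=.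
rewrite !big_ord_recl /= /Q /= add0r.
apply: le_trans (kraft M Ai); rewrite addrCA lerD2l mulrDl !mul1r.
by rewrite lerD // le_eqVlt; apply/orP; left; apply/eqP; apply: eq_bigr.
Qed.

Let weight C : R := \prod_(i | A i) Q i (keyf C i).

Let weightE C : weight C = expR (- \sum_(i | A i) c i (bucket i C)).
Proof.
rewrite -sumrN expR_sum; apply: eq_bigr => i Ai.
by rewrite ffunE Ai Q_key.
Qed.

(* Jensen's inequality for the exponential, through its tangent at [- B]. *)
Let sum_weight_ge :
  2 ^+ #|X| * expR (- (#|X|%:R / 16)) <= \sum_(C in powerset X) weight C.
Proof.
set B : R := #|X|%:R / 16.
pose co C := \sum_(i | A i) c i (bucket i C).
have h C : expR (- B) * (1 + B - co C) <= weight C.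
  rewrite weightE -/(co C).
  have -> : - co C = - B + (B - co C) by lra.
  rewrite expRD.
  apply: ler_wpM2l; first exact: expR_ge0.
  by apply: le_trans (expR_ge1Dx _); rewrite /B; lra.
apply: le_trans (ler_sum _ (fun C _ => h C)).
rewrite -mulr_sumr mulrC; apply: ler_wpM2l; first exact: expR_ge0.
rewrite big_split /= sumrN exchange_big /= sumr_const card_powerset.
rewrite -[_ *+ (2 ^ _)]mulr_natr natrX mulrDl mul1r.
by have := budget; rewrite -/B; lra.
Qed.

(* Any [z] in [(0, 1)] with [(1 + z ^+ 4) / z < 2 * (1 - 1 / 16)] would do: the
   subsets of [X] of cardinality at most [#|X| / 4] are counted with the weights
   [z ^+ (4 * #|S| - #|X|) >= 1]. *)
Let z : R := 5 / 6.

(** Group the colourings by key. Translated by one of its members, a fibre consists of sets of at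
    most [#|X| / 4] points, so its size is at most the right-hand side; the weights of all key
    families sum to a product of sums of [Q i], hence to at most 1. *)
Let sum_weight_le :
  (forall C C' : {set T}, C \subset X -> C' \subset X -> keyf C = keyf C' ->
     (4 * #|symdiff C C'| <= #|X|)%N) ->
  \sum_(C in powerset X) weight C <= ((1 + z ^+ 4) / z) ^+ #|X|.
Proof.
move=> close.
have z0 : 0 < z by rewrite /z; lra.
have z1 : z <= 1 by rewrite /z; lra.
set B := _ ^+ #|X|.
have B0 : 0 <= B by rewrite exprn_ge0 // divr_ge0 ?ltW // addr_gt0 // exprn_gt0.
have fibre f : \sum_(C in powerset X | keyf C == f) (1 : R) <= B.
  have [C0 /andP[C0X /eqP kC0]|none] := pickP (fun C => (C \in powerset X) && (keyf C == f));
    last by rewrite big_pred0.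
  rewrite /B expr_div_n ler_pdivlMr ?exprn_gt0 // mulr_suml.
  rewrite -sum_powerset_expr.
  rewrite powersetE in C0X; rewrite (@sum_powerset_symdiff _ _ X C0) //.
  rewrite [leRHS](bigID (fun C => keyf C == f)) /= -[leLHS]addr0.
  apply: lerD; last by apply: sumr_ge0 => *; rewrite !exprn_ge0 // ltW.
  apply: ler_sum => C /andP[]; rewrite powersetE => CX /eqP kC.
  rewrite mul1r -exprM; apply: ler_wiXn2l => //; first exact: ltW.
  by apply: close => //; rewrite kC kC0.
rewrite (@partition_big _ _ _ _ _ _ _ keyf (mem (pfamily j0 A (fun _ => predT)))) /=; last first.
  move=> C _; apply/pfamilyP; split=> // ; apply/supportP => i.
  by rewrite ffunE unfold_in => /negbTE ->.
apply: (@le_trans _ _ (\sum_(f in pfamily j0 A (fun _ => predT)) B * \prod_(i | A i) Q i (f i))).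
  apply: ler_sum => f _.
  have -> : \sum_(C in powerset X | keyf C == f) weight C =
      (\sum_(C in powerset X | keyf C == f) 1) * \prod_(i | A i) Q i (f i).
    rewrite mulr_suml; apply: eq_bigr => C /andP[_ /eqP <-]; rewrite mul1r //.
  by apply: ler_wpM2r (fibre f); exact: prodr_ge0.
rewrite -mulr_sumr -[leRHS]mulr1; apply: ler_wpM2l => //.
rewrite -(@big_distr_big_dep _ _ _ _ _ _ _ j0 A (fun _ => predT) Q).
apply: (@le_trans _ _ (\prod_(i | A i) 1)); last by rewrite big1.
apply: ler_prod => i Ai; rewrite sum_Q // andbT.
by apply: sumr_ge0.
Qed.

Lemma partial_colouring : (0 < #|X|)%N -> exists P N : {set T},
  [/\ P \subset X, N \subset X, [disjoint P & N], (#|X| < 4 * #|P :|: N|)%N &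
      forall i, A i -> `|#|P :&: S i|%:R - #|N :&: S i|%:R| <= D i].
Proof.
move=> X0.
have [/existsP[[C C'] /= /and4P[CX C'X /eqP kk far]]|none] := boolP
  [exists p : {set T} * {set T}, [&& p.1 \subset X, p.2 \subset X,
     keyf p.1 == keyf p.2 & (#|X| < 4 * #|symdiff p.1 p.2|)%N]].
  exists (C :\: C'), (C' :\: C); split=> //.
  - by apply: subset_trans CX; exact: subsetDl.
  - by apply: subset_trans C'X; exact: subsetDl.
  - apply/pred0P => x /=; rewrite !inE.
    by case: (x \in C); case: (x \in C').
  move=> i Ai.
  have := congr1 (fun f : {ffun _} => f i) kk; rewrite !ffunE Ai => -[sg].
  move/(congr1 (@nat_of_ord _)); rewrite !inordK ?ltnS ?bucket_le // => bk.
  have := bucket_close Ai bk sg.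
  have -> : sgnsum R C (S i) - sgnsum R C' (S i) =
     2 * (#|(C :\: C') :&: S i|%:R - #|(C' :\: C) :&: S i|%:R).
    rewrite /sgnsum -sumrB -!sum1_card !natr_sum.
    have E (B : {set T}) : \sum_(x in B :&: S i) (1 : R) =
        \sum_(x in S i) (x \in B)%:R.
      rewrite big_mkcond [RHS]big_mkcond /=; apply: eq_bigr => x _.
      by rewrite !inE; do 2!case: (x \in _).
    rewrite !E -sumrB mulr_sumr; apply: eq_bigr => x _; rewrite /sgn !inE.
    by case: (x \in C); case: (x \in C') => /=; lra.
  by rewrite normrM ger0_norm // ler_pM2l.
exfalso.
have := le_trans sum_weight_ge (sum_weight_le _).
have far (C C' : {set T}) : C \subset X -> C' \subset X -> keyf C = keyf C' ->
     (4 * #|symdiff C C'| <= #|X|)%N.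
  move=> CX C'X kk; move/existsPn: none => /(_ (C, C')) /=.
  by rewrite CX C'X kk eqxx /= -leqNgt.
move=> /(_ far); apply/negP; rewrite -ltNge.
(* Both bounds are powers with exponent [#|X| > 0], so it suffices to compare the bases: [1921 /
   1080 < 15 / 8 <= 2 * expR (- (1 / 16))]. *)
have -> : - (#|X|%:R / 16 : R) = #|X|%:R * (- (1 / 16)) by lra.
rewrite expRM_natl -exprMn ltr_pXn2r // ?nnegrE.
- have := expR_ge1Dx (- (1 / 16) : R); rewrite /z.
  have -> : (1 + (5 / 6 : R) ^+ 4) / (5 / 6) = 1921 / 1080 by field.
  lra.
- rewrite /z; have -> : (1 + (5 / 6 : R) ^+ 4) / (5 / 6) = 1921 / 1080 by field.
  lra.
- by rewrite mulr_ge0 // expR_ge0.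
Qed.

End PartialColouring.

(** * Thresholds and code lengths *)

Section Costs.
Variables (R : realType) (J : nat).

(** The fourth root of 2 turns quarter-integer exponents of 2 into natural ones. *)
Definition theta : R := Num.sqrt (Num.sqrt 2).

Lemma theta4 : theta ^+ 4 = 2.
Proof. by rewrite (exprM _ 2 2) sqr_sqrtr ?sqrtr_ge0 // sqr_sqrtr. Qed.

Lemma theta_gt0 : 0 < theta. Proof. by rewrite !sqrtr_gt0. Qed.

Lemma theta_ge : 7 / 6 <= theta.
Proof.
rewrite -(@ler_pXn2r _ 4) ?nnegrE //; last by rewrite ltW ?theta_gt0.
  by rewrite theta4; have -> : (7 / 6 : R) ^+ 4 = 2401 / 1296; [field|lra].
by lra.
Qed.

(* The discrepancy allowed to blocks of length [2 ^ j]. It is [2 ^ (j / 2)] times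
   [2 ^ ((J - j) / 4)] for [j <= J], which makes the eighth moment beat the number
   of blocks, and times [2 ^ (J - j)] for [j > J]. *)
Definition thr j : R :=
  if (j <= J)%N then theta ^+ (J + j) else theta ^+ (2 * j) / 2 ^+ (j - J).

(** For [j <= J] bucket zero is the expected one and is made cheap. For [j > J] the threshold is the
    standard deviation divided by [2 ^ (j - J)], so typical buckets have index of order
    [2 ^ (j - J)]: naming one costs about [j - J], and the price then rises slowly with [k]. *)
Definition code j k : R :=
  if (j <= J)%N then (if k == 0%N then (4 ^+ (J - j))^-1
                      else (2 * (J - j) + 2 + k)%:R)
  else (j - J + 2)%:R + k%:R / 2 ^+ (j - J).

Definition mean_code j : R :=
  if (j <= J)%N then (1 + 105 * (2 * (J - j) + 3)%:R) / 4 ^+ (J - j)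
  else (j - J + 3)%:R.

Lemma thr_gt0 j : 0 < thr j.
Proof.
by rewrite /thr; case: ifP => _; rewrite ?divr_gt0 ?exprn_gt0 ?theta_gt0.
Qed.

Lemma sum_expR_geo (y : R) M : 0 <= y ->
  (\sum_(k < M) expR (- (k.+1%:R * y))) * y <= 1.
Proof.
move=> y0; set x := expR (- y).
have xE k : expR (- (k%:R * y)) = x ^+ k by rewrite -mulrN expRM_natl.
have xy : x * y <= 1 - x.
  have : x * (1 + y) <= 1.
    by rewrite /x expRN mulrC ler_pdivrMr ?expR_gt0 // mul1r expR_ge1Dx.
  by rewrite mulrDr mulr1; lra.
(* The induction needs the tail [x ^+ M] of the geometric series. *)
suff: (\sum_(k < M) expR (- (k.+1%:R * y))) * y <= 1 - x ^+ M.
  by move/le_trans; apply; rewrite gerBl exprn_ge0 // expR_ge0.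
elim: M => [|M IH]; first by rewrite big_ord0 mul0r expr0 subrr.
rewrite big_ord_recr /= mulrDl xE.
have : x ^+ M * (x * y) <= x ^+ M * (1 - x).
  by apply: ler_wpM2l => //; rewrite exprn_ge0 // expR_ge0.
by rewrite exprSr mulrA mulrBr mulr1; lra.
Qed.

Lemma expRN_nat_le n : expR (- n%:R : R) <= (2 ^+ n)^-1.
Proof.
rewrite expRN lef_pV2 ?posrE ?exprn_gt0 ?expR_gt0 //.
rewrite -[n%:R]mulr1 expRM_natl lerXn2r ?nnegrE ?expR_ge0 //.
by have := expR_ge1Dx (1 : R); lra.
Qed.

Lemma code_kraft j M :
  expR (- code j 0%N) + 2 * \sum_(k < M) expR (- code j k.+1) <= 1.
Proof.
rewrite /code; case: leqP => [le_jJ|lt_Jj] /=.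
  (* Bucket zero has weight at most [1 - c0 / 2], and the offset [2 * i + 2] keeps the other buckets
     within the remaining [c0 / 2]. *)
  set i := (J - j)%N; set c0 : R := (4 ^+ i)^-1.
  have c00 : 0 < c0 by rewrite invr_gt0 exprn_gt0.
  have c01 : c0 <= 1 by rewrite invf_le1 ?exprn_gt0 // exprn_ege1 //; lra.
  have h0 : expR (- c0) <= 1 - c0 / 2.
    have e1 := expR_ge1Dx c0.
    rewrite expRN; apply: (@le_trans _ _ (1 + c0)^-1).
      by rewrite lef_pV2 // ?posrE ?expR_gt0 //; lra.
    by rewrite -div1r ler_pdivrMr; nra.
  have -> : \sum_(k < M) expR (- (2 * i + 2 + k.+1)%:R : R) =
      expR (- (2 * i + 2)%:R) * \sum_(k < M) expR (- (k.+1%:R * 1)).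
    rewrite mulr_sumr; apply: eq_bigr => k _.
    by rewrite -expRD mulr1 natrD opprD.
  have := @sum_expR_geo 1 M ler01; rewrite mulr1.
  set s := \sum_(k < M) _ => s1.
  have s0 : 0 <= s by apply: sumr_ge0 => k _; exact: expR_ge0.
  have := expRN_nat_le (2 * i + 2).
  have -> : (2 ^+ (2 * i + 2) : R)^-1 = c0 / 4.
    by rewrite exprD exprM invfM /c0; congr (_ / _); [congr ((_ ^+ _)^-1)|]; lra.
  set e := expR _ => ec; have e0 : 0 <= e by exact: expR_ge0.
  have : e * s <= e * 1 by apply: ler_wpM2l.
  lra.
(* Here the total is at most [(2 ^+ (t + 2))^-1 * (1 + 2 * 2 ^+ t) <= 3 / 4]. *)
set t := (j - J)%N; rewrite mul0r addr0.
have -> : \sum_(k < M) expR (- ((t + 2)%:R + k.+1%:R / 2 ^+ t) : R) =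
    expR (- (t + 2)%:R) * \sum_(k < M) expR (- (k.+1%:R * (2 ^+ t)^-1)).
  by rewrite mulr_sumr; apply: eq_bigr => k _; rewrite -expRD opprD.
have p0 : (0 : R) < 2 ^+ t by rewrite exprn_gt0.
have p1 : (1 : R) <= 2 ^+ t by rewrite exprn_ege1 //; lra.
have := @sum_expR_geo (2 ^+ t)^-1 M; rewrite invr_ge0 ltW // => /(_ isT).
rewrite ler_pdivrMr // mul1r.
set s := \sum_(k < M) _ => s1.
have := expRN_nat_le (t + 2).
set e := expR _ => ec; have e0 : 0 <= e by exact: expR_ge0.
have : e * (1 + 2 * s) <= (2 ^+ (t + 2))^-1 * (1 + 2 * 2 ^+ t).
  apply: ler_pM => //; last by lra.
  by rewrite addr_ge0 // mulr_ge0 // sumr_ge0 // => k _; exact: expR_ge0.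
have -> : (2 ^+ (t + 2) : R)^-1 * (1 + 2 * 2 ^+ t) = (2 ^+ t)^-1 / 4 + 1 / 2.
  by rewrite exprD; field; rewrite lt0r_neq0.
have : (2 ^+ t : R)^-1 <= 1 by rewrite invf_le1.
lra.
Qed.

(** For [j <= J], [thr j ^+ 8] is [4 ^+ (J - j)] times [#|S| ^ 4], and a nonzero bucket [k] costs at
    most [(2 * (J - j) + 3) * k ^ 8], so the eighth moment suffices. For [j > J] the cost is linear
    in the sum and [y <= (1 + y ^+ 2) / 2] reduces it to the second moment. *)
Lemma sum_code_le (T : finType) (X S : {set T}) j :
  S \subset X -> #|S| = (2 ^ j)%N ->
  \sum_(C in powerset X) code j (Num.truncn (`|sgnsum R C S| / thr j))
    <= mean_code j * 2 ^+ #|X|.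
Proof.
move=> sSX cS; have [m2 _ _ m8] := @sgnsum_moments R T X S sSX.
have cX : \sum_(C in powerset X) (1 : R) = 2 ^+ #|X|.
  by rewrite sumr_const card_powerset natrX.
have D0 := thr_gt0 j.
have tr (x : R) : (Num.truncn (`|x| / thr j))%:R <= `|x| / thr j.
  by rewrite truncn_le divr_ge0 // ltW.
rewrite /code /mean_code; case: leqP => [le_jJ|lt_Jj].
  set i := (J - j)%N.
  have D8 : thr j ^+ 8 = 4 ^+ i * (2 ^ j)%:R ^+ 4.
    rewrite /thr le_jJ -exprM (_ : ((J + j) * 8)%N = (4 * (2 * (i + 2 * j)))%N);
      last by rewrite /i; lia.
    rewrite exprM theta4 exprM natrX (_ : (2 : R) ^+ 2 = 4); last by ring.
    rewrite exprD exprM (_ : (4 : R) ^+ 2 = 2 ^+ 4); last by ring.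
    by rewrite -!exprM mulnC.
  pose a : R := (2 * i + 3)%:R.
  have h C : (if Num.truncn (`|sgnsum R C S| / thr j) == 0%N then (4 ^+ i)^-1
     else (2 * i + 2 + Num.truncn (`|sgnsum R C S| / thr j))%:R) <=
     (4 ^+ i)^-1 + a * (sgnsum R C S ^+ 8 / thr j ^+ 8).
    set x := sgnsum R C S; set k := Num.truncn _.
    have q0 : 0 <= x ^+ 8 / thr j ^+ 8.
      by rewrite divr_ge0 // ?(exprM _ 2 4) ?exprn_even_ge0.
    have a0 : 0 <= a by rewrite ler0n.
    case: (posnP k) => [_|k0]; first by rewrite lerDl mulr_ge0.
    apply: (@le_trans _ _ (a * k%:R ^+ 8)).
      rewrite /a -natrX -natrM ler_nat.
      apply: (@leq_trans ((2 * i + 3) * k)); first by nia.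
      by rewrite leq_mul2l -{1}[k]expn1 leq_pexp2l // orbT.
    apply: (@le_trans _ _ (a * (x ^+ 8 / thr j ^+ 8))); last first.
      by rewrite lerDr invr_ge0 exprn_ge0.
    apply: ler_wpM2l => //.
    have -> : x ^+ 8 / thr j ^+ 8 = (`|x| / thr j) ^+ 8.
      by rewrite expr_div_n -normrX ger0_norm // (exprM _ 2 4) exprn_even_ge0.
    by apply: lerXn2r; rewrite ?nnegrE ?ler0n ?divr_ge0 ?(ltW D0) ?tr.
  apply: le_trans (ler_sum _ (fun C _ => h C)) _.
  rewrite big_split /= -mulr_sumr -mulr_suml.
  have -> : \sum_(C in powerset X) (4 ^+ i)^-1 = (4 ^+ i)^-1 * 2 ^+ #|X| :> R.
    by rewrite -cX mulr_sumr; apply: eq_bigr => *; rewrite mulr1.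
  rewrite [leRHS](_ : _ = (4 ^+ i)^-1 * 2 ^+ #|X| +
      a * (105 * (4 ^+ i)^-1 * 2 ^+ #|X|)); last by rewrite /a; ring.
  rewrite lerD2l; apply: ler_wpM2l; first by rewrite ler0n.
  rewrite ler_pdivrMr ?exprn_gt0 // (le_trans m8) // cS D8.
  rewrite le_eqVlt; apply/orP; left; apply/eqP; field.
  by rewrite lt0r_neq0 // exprn_gt0.
set t := (j - J)%N.
pose w : R := theta ^+ (2 * j).
have w0 : 0 < w by rewrite exprn_gt0 ?theta_gt0.
have w2 : w ^+ 2 = (2 ^ j)%:R.
  by rewrite /w -exprM natrX -theta4 -exprM; congr (_ ^+ _); lia.
have h C : (t + 2)%:R + (Num.truncn (`|sgnsum R C S| / thr j))%:R / 2 ^+ t <=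
    (t + 2)%:R + 1 / 2 + sgnsum R C S ^+ 2 / w ^+ 2 / 2.
  set x := sgnsum R C S; rewrite -addrA lerD2l.
  apply: (@le_trans _ _ (`|x| / w)).
    rewrite ler_pdivrMr ?exprn_gt0 //; apply: le_trans (tr x) _.
    by rewrite /thr leqNgt lt_Jj /= -/w -/t invf_div mulrA mulrAC.
  have -> : x ^+ 2 / w ^+ 2 = (`|x| / w) ^+ 2 by rewrite expr_div_n real_normK ?num_real.
  have := sqr_ge0 (`|x| / w - 1); nra.
apply: le_trans (ler_sum _ (fun C _ => h C)) _.
rewrite big_split /= -!mulr_suml m2 cS w2.
have -> : \sum_(C in powerset X) ((t + 2)%:R + 1 / 2) =
    ((t + 2)%:R + 1 / 2) * 2 ^+ #|X| :> R.
  by rewrite -cX mulr_sumr; apply: eq_bigr => *; rewrite mulr1.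
rewrite le_eqVlt; apply/orP; left; apply/eqP.
have : (2 ^ j)%:R != 0 :> R by rewrite pnatr_eq0 -lt0n expn_gt0.
by move: (2 ^ j)%:R => v v0; rewrite !natrD; field.
Qed.

End Costs.

(** * Chaining and iteration *)

Section Chaining.
Variables (R : realType) (F d : nat -> R) (L : nat).
Hypothesis d_ge0 : forall j, 0 <= d j.

(** With [F] a prefix sum, these differences are the sums over complete dyadic blocks. *)
Definition blocks_below t := forall j k, (j < t)%N -> (k.+1 * 2 ^ j <= L)%N ->
  `|F (k.+1 * 2 ^ j)%N - F (k * 2 ^ j)%N| <= d j.

(** Round [a] down to multiples of [2 ^ j] for increasing [j]: passing from [2 ^ t] to [2 ^ t.+1]
    crosses one block exactly when the quotient is odd. *)
Lemma chain_floor t a : blocks_below t -> (a <= L)%N ->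
  `|F a - F (a %/ 2 ^ t * 2 ^ t)%N| <= \sum_(j < t) d j.
Proof.
elim: t => [|t IH] bl aL; first by rewrite expn0 divn1 muln1 subrr normr0 big_ord0.
rewrite big_ord_recr /=.
have := IH (fun j k jt => bl j k (ltnW jt)) aL.
set q := (a %/ 2 ^ t)%N => le1.
have -> : (a %/ 2 ^ t.+1 = q./2)%N by rewrite expnSr divnMA divn2.
have le2 : `|F (q * 2 ^ t)%N - F (q./2 * 2 ^ t.+1)%N| <= d t.
  have -> : (q./2 * 2 ^ t.+1 = q./2.*2 * 2 ^ t)%N.
    by rewrite expnS mulnA muln2.
  have qL : (q * 2 ^ t <= L)%N by apply: leq_trans aL; exact: leq_trunc_div.
  move: qL; rewrite -{1 2}(odd_double_half q); case: (odd q) => qL.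
    exact: bl.
  by rewrite add0n subrr normr0.
apply: le_trans (lerD le1 le2).
rewrite -[X in `|X| <= _](subrKA (F (q * 2 ^ t)%N)).
exact: ler_normD.
Qed.

(** Round both ends down to multiples of [2 ^ t]. Since [b - a < 2 ^ t.+1], the rounded ends are at
    most two blocks apart. *)
Lemma chain_interval t a b : blocks_below t.+1 -> (a <= b <= L)%N ->
  (b - a < 2 ^ t.+1)%N -> `|F b - F a| <= 2 * \sum_(j < t.+1) d j.
Proof.
move=> bl /andP[ab bL] lt; have aL := leq_trans ab bL.
have bl' : blocks_below t by move=> j k jt; exact: bl (ltnW jt).
have := chain_floor bl' aL; have := chain_floor bl' bL.
set qa := (a %/ 2 ^ t)%N; set qb := (b %/ 2 ^ t)%N => cb ca.
have qab : (qa <= qb)%N by exact: leq_div2r.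
have qb2 : (qb <= qa + 2)%N.
  rewrite -ltnS /qb ltn_divLR ?expn_gt0 //.
  have := ltn_ceil a (_ : (0 < 2 ^ t)%N); rewrite expn_gt0 -/qa => /(_ isT).
  by move: lt; rewrite expnS; lia.
have qbL : (qb * 2 ^ t <= L)%N by apply: leq_trans bL; exact: leq_trunc_div.
have mid : `|F (qb * 2 ^ t)%N - F (qa * 2 ^ t)%N| <= 2 * d t.
  have dt := d_ge0 t.
  have st q : (q < qb)%N -> `|F (q.+1 * 2 ^ t)%N - F (q * 2 ^ t)%N| <= d t.
    move=> q_lt; apply: bl => //; apply: leq_trans qbL.
    by rewrite leq_mul2r q_lt orbT.
  have [e|[e|e]] : qb = qa \/ qb = qa.+1 \/ qb = qa.+2 by lia.
  - by rewrite e subrr normr0; lra.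
  - by have := st qa; rewrite {1}e ltnSn -e => /(_ isT); lra.
  - have := st qa; have := st qa.+1; rewrite e ltnSn (ltnW (ltnSn _)).
    move=> /(_ isT) s1 /(_ isT) s2.
    rewrite -[X in `|X| <= _](subrKA (F (qa.+1 * 2 ^ t)%N)).
    by apply: le_trans (ler_normD _ _) _; lra.
rewrite big_ord_recr /=.
have -> : F b - F a = (F b - F (qb * 2 ^ t)%N) +
   (F (qb * 2 ^ t)%N - F (qa * 2 ^ t)%N) - (F a - F (qa * 2 ^ t)%N) by ring.
apply: le_trans (ler_normB _ _) _.
by have := ler_normD (F b - F (qb * 2 ^ t)%N) (F (qb * 2 ^ t)%N - F (qa * 2 ^ t)%N); lra.
Qed.

End Chaining.

(** * Colouring against short intervals of a family of lists *)

Section Intervals.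
Variables (R : realType) (T I : finType) (z : I -> seq T) (cap : I -> nat).
Variables (J U : nat).
Hypothesis z_uniq : forall i, uniq (z i).
Hypothesis cardT : (#|T| <= 2 ^ U)%N.
Hypothesis sparse :
  \sum_(j < U.+1) #|[set i | (2 ^ j <= cap i)%N]|%:R / 2 ^+ j * mean_code R J j
    <= 1 / 16.

Let seg i (X : {set T}) := [seq x <- z i | x \in X].

Let seg_uniq i X : uniq (seg i X). Proof. exact: filter_uniq. Qed.

Lemma size_uniq_sub (s : seq T) (X : {set T}) :
  uniq s -> {subset s <= X} -> (size s <= #|X|)%N.
Proof.
move=> us sX; rewrite -(card_uniqP us) subset_leq_card //.
by apply/subsetP => x; exact: sX.
Qed.

Let size_seg i X : (size (seg i X) <= #|X|)%N.
Proof.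
by apply: size_uniq_sub => // x; rewrite mem_filter => /andP[].
Qed.

(** The chaining bound for an interval meeting at most [2 ^ u] uncoloured points. *)
Definition gap u : R := 2 * \sum_(j < u.+1) thr R J j.

Lemma gap_ge0 u : 0 <= gap u.
Proof. by rewrite mulr_ge0 // sumr_ge0 // => j _; rewrite ltW ?thr_gt0. Qed.

(** A block is given by its level, its list and its position. Only complete blocks of the list
    restricted to [X] enter the system [AX]. *)
Let K : finType := ('I_U.+1 * (I * 'I_#|T|.+1))%type.
Let blk X (a : K) := [set x in take (2 ^ a.1) (drop (a.2.2 * 2 ^ a.1) (seg a.2.1 X))].
Let AX X (a : K) :=
  (2 ^ a.1 <= cap a.2.1)%N && (a.2.2.+1 * 2 ^ a.1 <= size (seg a.2.1 X))%N.

Let blk_sub X a : blk X a \subset X.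
Proof.
apply/subsetP => x; rewrite inE => /mem_take/mem_drop.
by rewrite mem_filter => /andP[].
Qed.

Let card_blk X a : AX X a -> #|blk X a| = (2 ^ a.1)%N.
Proof.
case/andP=> _ le; rewrite cardsE; have /card_uniqP -> : uniq (take (2 ^ a.1)
  (drop (a.2.2 * 2 ^ a.1) (seg a.2.1 X))) by rewrite take_uniq ?drop_uniq.
rewrite size_take size_drop; case: ltnP => // le2; apply/eqP.
rewrite eqn_leq le2 /=; move: le; rewrite mulSn.
by move: (2 ^ _)%N (_ * _)%N (size _) => e f g; lia.
Qed.

Let count_ord_ltn N q : (#|[set k : 'I_N | (k < q)%N]| <= q)%N.
Proof.
rewrite cardE -(size_map (@nat_of_ord N)) -[q in leqRHS](size_iota 0).
apply: uniq_leq_size; first by rewrite map_inj_uniq ?enum_uniq //; exact: val_inj.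
by move=> x /mapP[k]; rewrite mem_enum inE => kq ->; rewrite mem_iota.
Qed.

(** Each list has at most [#|X| / 2 ^ j] complete blocks of length [2 ^ j], each of mean cost at
    most [mean_code j], so [sparse] multiplied by [#|X|] is the entropy budget. *)
Let block_budget X :
  \sum_(a | AX X a) \sum_(C in powerset X)
     code R J a.1 (bucket (blk X) (fun a => thr R J a.1) a C)
  <= #|X|%:R / 16 * 2 ^+ #|X|.
Proof.
have p0 (e : nat) : (0 : R) < 2 ^+ e by rewrite exprn_gt0.
have mc0 j : 0 <= mean_code R J j.
  by rewrite /mean_code; case: ifP => _; rewrite ?divr_ge0 ?addr_ge0 ?mulr_ge0 ?exprn_ge0.
apply: (@le_trans _ _ (\sum_(a | AX X a) mean_code R J a.1 * 2 ^+ #|X|)).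
  by apply: ler_sum => a Aa; apply: sum_code_le; [exact: blk_sub|exact: card_blk].
rewrite -mulr_suml; apply: ler_wpM2r; first exact: ltW.
have -> : \sum_(a | AX X a) mean_code R J a.1 = \sum_(j < U.+1)
    \sum_(i | (2 ^ j <= cap i)%N)
    \sum_(k < #|T|.+1 | (k.+1 * 2 ^ j <= size (seg i X))%N) mean_code R J j.
  symmetry; under eq_bigr do rewrite pair_big_dep /=.
  by rewrite pair_big_dep /=; apply: eq_bigl => -[j [i k]].
apply: (@le_trans _ _ (\sum_(j < U.+1) (#|[set i | (2 ^ j <= cap i)%N]|%:R / 2 ^+ j
   * mean_code R J j) * #|X|%:R)); last first.
  rewrite -mulr_suml mulrC; apply: ler_wpM2l => //.
  by move: sparse; rewrite mul1r.
apply: ler_sum => j _.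
apply: (@le_trans _ _ (\sum_(i | (2 ^ j <= cap i)%N)
   (#|X|%:R / 2 ^+ j * mean_code R J j))).
  apply: ler_sum => i _; rewrite sumr_const -[leLHS]mulr_natl.
  apply: ler_wpM2r => //; rewrite ler_pdivlMr // -natrX -natrM ler_nat.
  have := count_ord_ltn #|T|.+1 (size (seg i X) %/ 2 ^ j).
  rewrite cardsE => h; apply: leq_trans (size_seg i X).
  apply: leq_trans (leq_trunc_div _ (2 ^ j)).
  rewrite leq_mul2r; apply/orP; right; apply: leq_trans h.
  rewrite leq_eqVlt; apply/orP; left; apply/eqP; apply: eq_card => k.
  change ((k.+1 * 2 ^ j <= size (seg i X))%N = (k < size (seg i X) %/ 2 ^ j)%N).
  by rewrite leq_divRL ?expn_gt0.
rewrite sumr_const cardsE -[leLHS]mulr_natl le_eqVlt; apply/orP; left; apply/eqP.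
by ring.
Qed.

Let sum_take_drop (s : seq T) (v : T -> R) a b : 
  \sum_(x <- take b (drop a s)) v x =
  \sum_(x <- take (a + b) s) v x - \sum_(x <- take a s) v x.
Proof. by rewrite takeD big_cat /= addrAC subrr add0r. Qed.

Lemma round u (X : {set T}) : (0 < #|X| <= 2 ^ u)%N -> exists P N : {set T},
  [/\ P \subset X, N \subset X, [disjoint P & N], (#|X| < 4 * #|P :|: N|)%N &
   forall i y, infix y (z i) -> (size y <= cap i)%N ->
     `|\sum_(x <- y) ((x \in P)%:R - (x \in N)%:R)| <= gap u].
Proof.
case/andP=> X0 Xu.
have [P [N [PX NX PN big disc]]] := @partial_colouring R T K
  (AX X) X (blk X) (fun a => thr R J a.1) (fun a => code R J a.1)
  (fun (a : K) (_ : AX X a) => thr_gt0 R J a.1)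
  (fun (a : K) M (_ : AX X a) => code_kraft R J a.1 M)
  (block_budget X) X0.
exists P, N; split=> // i y /infixP[p [q zE]] ycap.
pose v x : R := (x \in P)%:R - (x \in N)%:R.
have v0 x : x \notin X -> v x = 0.
  move=> xX; rewrite /v (negbTE (contra (subsetP PX x) xX)).
  by rewrite (negbTE (contra (subsetP NX x) xX)) subrr.
pose s := seg i X.
pose fp := [seq x <- p | x \in X]; pose fy := [seq x <- y | x \in X].
pose fq := [seq x <- q | x \in X].
have sE : s = fp ++ fy ++ fq by rewrite /s /seg zE !filter_cat.
pose F a := \sum_(x <- take a s) v x.
(* Points outside [X] contribute 0, so the sum over [y] is one over an interval of the restricted
   list. *)
have -> : \sum_(x <- y) v x = F (size fp + size fy)%N - F (size fp).
  rewrite -sum_take_drop sE drop_size_cat // take_size_cat // big_filter.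
  rewrite [RHS]big_mkcond /=; apply: eq_bigr => x _.
  by case: ifP => // /negbT/v0.
have [->|fy0] := posnP (size fy).
  by rewrite addn0 subrr normr0 gap_ge0.
set t := trunc_log 2 (size fy).
have /andP[t1 t2] := trunc_log_bounds (isT : (1 < 2)%N) fy0; rewrite -/t in t1 t2.
have fym : (size fy <= #|X|)%N.
  apply: leq_trans (size_seg i X); rewrite -/(seg i X) -/s sE !size_cat; lia.
have tu : (t <= u)%N by rewrite -(@leq_exp2l 2) //; lia.
have tU : (t <= U)%N.
  rewrite -(@leq_exp2l 2) //; apply: leq_trans cardT.
  by apply: leq_trans t1 (leq_trans fym (max_card _)).
have sT : (size s <= #|T|)%N by apply: leq_trans (size_seg i X) (max_card _).
apply: (@le_trans _ _ (2 * \sum_(j < t.+1) thr R J j)); last first.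
  rewrite /gap ler_pM2l // -(subnKC (_ : t.+1 <= u.+1)%N) // big_split_ord /=.
  by rewrite lerDl sumr_ge0 // => j _; rewrite ltW ?thr_gt0.
apply: (@chain_interval R F (thr R J) (size s)).
- by move=> j; rewrite ltW ?thr_gt0.
- move=> j k jt kL.
  have kT : (k < #|T|.+1)%N.
    have : (0 < 2 ^ j)%N by rewrite expn_gt0.
    by move: kL sT; nia.
  have jU : (j < U.+1)%N by lia.
  pose a : K := (Ordinal jU, (i, Ordinal kT)).
  (* Restricting to [X] only shortens [y], so every block in the chain obeys the cap. *)
  have ycap' : (2 ^ j <= cap i)%N.
    apply: leq_trans ycap; apply: leq_trans (_ : size fy <= _)%N.
      by apply: leq_trans t1; rewrite leq_exp2l.
    by rewrite size_filter count_size.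
  have Aa : AX X a by rewrite /AX /= ycap' kL.
  have := disc a Aa; congr (`|_| <= _).
  rewrite mulSn [(_ + k * _)%N]addnC -sum_take_drop.
  have E (B : {set T}) : #|B :&: blk X a|%:R =
     \sum_(x <- take (2 ^ j) (drop (k * 2 ^ j) s)) (x \in B)%:R :> R.
    rewrite -natr_sum; congr (_%:R).
    rewrite big_uniq ?take_uniq ?drop_uniq ?seg_uniq //=.
    rewrite -sum1_card big_mkcond [RHS]big_mkcond /=; apply: eq_bigr => x _.
    by rewrite !inE; do 2!case: (x \in _).
  by rewrite !E -sumrB.
- by rewrite leq_addr sE !size_cat addnA leq_addr.
- by rewrite addnC addnK.
Qed.

Definition colourable (X : {set T}) (B : R) := exists C : {set T},
  forall i y, infix y (z i) -> (size y <= cap i)%N ->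
    `|\sum_(x <- y | x \in X) sgn R C x| <= B.

Lemma colour_round u (X : {set T}) : (#|X| <= 2 ^ u)%N -> exists X' : {set T},
  (4 * #|X'| <= 3 * #|X|)%N /\
  forall B, colourable X' B -> colourable X (gap u + B).
Proof.
move=> Xu; have [X0|X0] := posnP #|X|.
  exists X; split; first by rewrite X0.
  move=> B [C hC]; exists C => i y yz yc; apply: le_trans (hC i y yz yc) _.
  by rewrite lerDr gap_ge0.
have /round[P [N [PX NX PN big disc]]] : (0 < #|X| <= 2 ^ u)%N by rewrite X0.
exists (X :\: (P :|: N)); split.
  have : (#|X :\: (P :|: N)| + #|P :|: N| = #|X|)%N.
    rewrite cardsD (setIidPr _) ?subUset ?PX // subnK //.
    by rewrite subset_leq_card // subUset PX.
  by lia.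
(* [C] is unconstrained outside [X'], so [N] must be removed for its points to receive -1. *)
move=> B [C hC]; exists (P :|: (C :\: N)) => i y yz yc.
have := le_trans (ler_normD _ _) (lerD (disc i y yz yc) (hC i y yz yc)).
congr (`|_| <= _); rewrite [X in _ + X = _]big_mkcond [RHS]big_mkcond -big_split /=.
apply: eq_bigr => x _; rewrite /sgn !inE.
have := subsetP PX x; have := subsetP NX x.
have := pred0P PN x; rewrite /=.
case: (x \in P); case: (x \in N); case: (x \in X) => //= _ h1 h2;
  try (by have := h1 isT); try (by have := h2 isT);
  case: (x \in C); rewrite /=; lra.
Qed.

(** Three rounds per scale halve [X], because [(3 / 4) ^ 3 = 27 / 64 <= 1 / 2]. At the end at most
    one point remains, which accounts for the summand 1. *)
Lemma colourable_all u (X : {set T}) : (#|X| <= 2 ^ u)%N ->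
  colourable X (1 + \sum_(t < u.+1) 3 * gap t).
Proof.
elim: u X => [|u IH] X Xu.
  exists X => i y yz _; apply: (@le_trans _ _ 1); last first.
    by rewrite lerDl sumr_ge0 // => t _; rewrite mulr_ge0 ?gap_ge0.
  apply: le_trans (ler_norm_sum _ _ _) _.
  apply: (@le_trans _ _ (\sum_(x <- y | x \in X) 1)).
    by apply: ler_sum => x _; rewrite /sgn; case: ifP; rewrite ?normrN normr1.
  have -> : \sum_(x <- y | x \in X) (1 : R) = (size [seq x <- y | x \in X])%:R.
    by rewrite size_filter -sum1_count natr_sum.
  rewrite -[leRHS]/(1%:R) ler_nat.
  apply: leq_trans Xu; apply: size_uniq_sub; last first.
    by move=> x; rewrite mem_filter => /andP[].
  by rewrite filter_uniq // (infix_uniq yz).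
have [X1 [c1 h1]] := colour_round Xu.
have [|X2 [c2 h2]] := @colour_round u.+1 X1; first by lia.
have [|X3 [c3 h3]] := @colour_round u.+1 X2; first by lia.
have /IH : (#|X3| <= 2 ^ u)%N by rewrite expnS in Xu; lia.
move/h3/h2/h1; congr colourable.
by rewrite [in RHS]big_ord_recr /=; ring.
Qed.

End Intervals.

(** * Geometric sums *)

Section Sums.
Variables (R : realType) (J : nat).
Local Notation theta := (theta R).

(** The factor 7 is the geometric series of ratio [6 / 7 >= 1 / theta]. *)
Lemma theta_geo_le (f : nat -> R) b u : 0 <= b ->
  (forall t, (t <= u)%N -> f t <= b * theta ^+ (J + t)) ->
  \sum_(t < u.+1) f t <= 7 * b * theta ^+ (J + u).
Proof.
move=> b0; elim: u => [|u IH] h.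
  rewrite big_ord_recl big_ord0 addr0 (le_trans (h _ _)) //.
  apply: ler_wpM2r; last by lra.
  by rewrite exprn_ge0 // ltW ?theta_gt0.
rewrite big_ord_recr /=.
have := IH (fun t tu => h t (leqW tu)); have := h u.+1 (leqnn _).
rewrite !addnS exprS; set w := theta ^+ _.
have w0 : 0 <= b * w by rewrite mulr_ge0 // exprn_ge0 // ltW ?theta_gt0.
have : (b * w) * (7 / 6) <= (b * w) * theta by rewrite ler_wpM2l ?theta_ge.
rewrite mulrA; lra.
Qed.

Lemma sum_thr_low u : (u <= J)%N ->
  \sum_(j < u.+1) thr R J j <= 7 * theta ^+ (J + u).
Proof.
move=> uJ; have -> : 7 * theta ^+ (J + u) = 7 * 1 * theta ^+ (J + u) by ring.
by apply: theta_geo_le => // t tu; rewrite /thr (leq_trans tu uJ) mul1r.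
Qed.

Lemma sum_thr_high k :
  \sum_(j < (J + k).+1) thr R J j <= 11 * theta ^+ (2 * J).
Proof.
pose r : R := theta ^+ 2 / 2.
have t2 : theta ^+ 2 <= 8 / 5.
  rewrite -(@ler_pXn2r _ 2) ?nnegrE ?exprn_ge0 ?(ltW (theta_gt0 _)) //; last by lra.
  by rewrite -exprM theta4; lra.
have r0 : 0 <= r by rewrite divr_ge0 // exprn_ge0 // ltW ?theta_gt0.
have r1 : r <= 4 / 5 by rewrite /r; lra.
set w := theta ^+ (2 * J); have w0 : 0 <= w by rewrite exprn_ge0 // ltW ?theta_gt0.
(* At [k = 0] this is the constant 7 of [sum_thr_low]; the inductive step amounts to
   [r <= 4 - 4 * r], that is [r <= 4 / 5]. *)
suff: \sum_(j < (J + k).+1) thr R J j <= w * (11 - 4 * r ^+ k).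
  move/le_trans; apply; rewrite mulrC ler_wpM2r //.
  by have := exprn_ge0 k r0; lra.
elim: k => [|k IH].
  have := sum_thr_low (leqnn J); rewrite addn0 expr0 addnn -mul2n -/w; lra.
rewrite addnS big_ord_recr /=.
have -> : thr R J (J + k).+1 = w * r ^+ k.+1.
  rewrite /thr ltnNge leq_addr /= -addnS addKn mulnDr exprD -/w -mulrA.
  by rewrite [theta ^+ (2 * _)]exprM -expr_div_n.
have : w * (r ^+ k * r) <= w * (r ^+ k * (4 - 4 * r)).
  by rewrite ler_wpM2l // ler_wpM2l ?exprn_ge0 //; lra.
by move: IH; rewrite exprSr; lra.
Qed.

(** The scales up to [J] form a geometric sum dominated by the last, with [294 = 3 * 14 * 7]. Each
    of the [k] scales above [J] adds at most [66 * w], and [361 = 1 + 294 + 66]. *)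
Lemma gap_sum_le k :
  1 + \sum_(t < (J + k).+1) 3 * gap R J t <= 361 * theta ^+ (2 * J) * k.+1%:R.
Proof.
set w := theta ^+ (2 * J).
have w1 : 1 <= w by rewrite exprn_ege1 //; have := theta_ge R; lra.
have low : \sum_(t < J.+1) 3 * gap R J t <= 294 * w.
  have := @theta_geo_le (fun t => 3 * gap R J t) 42 J.
  rewrite addnn -mul2n -/w => /(_ _ _)/le_trans; apply=> //; last by lra.
  by move=> t tJ; have := sum_thr_low tJ; rewrite /gap; lra.
suff: \sum_(t < (J + k).+1) 3 * gap R J t <= w * (294 + 66 * k%:R).
  move=> h; rewrite -[k.+1%:R]natr1; have : 0 <= w * k%:R by rewrite mulr_ge0 //; lra.
  by move: h; lra.
elim: k => [|k IH]; first by rewrite addn0 mulr0 addr0 mulrC.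
rewrite addnS big_ord_recr /= -[k.+1%:R]natr1.
have h : gap R J (J + k).+1 <= 22 * w.
  by have := sum_thr_high k.+1; rewrite addnS -/w /gap; lra.
move: h IH; move: (gap R J (J + k).+1) (\sum_(t < _) _) => x y.
by clearbody w; lra.
Qed.

Lemma sum_poly2_geo N :
  \sum_(i < N) ((i.+1 * i.+2)%:R / 2 ^+ i : R) <= 16.
Proof.
suff: \sum_(i < N) ((i.+1 * i.+2)%:R / 2 ^+ i : R) =
    16 - (2 * N%:R ^+ 2 + 10 * N%:R + 16) / 2 ^+ N.
  move=> ->; rewrite gerBl divr_ge0 ?exprn_ge0 //.
  by rewrite !addr_ge0 ?mulr_ge0 ?exprn_ge0.
elim: N => [|N IH]; first by rewrite big_ord0 expr0; field.
rewrite big_ord_recr /= IH [2 ^+ N.+1]exprS natrM.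
by field; rewrite lt0r_neq0 // exprn_gt0.
Qed.

Lemma sum_poly1_geo N : \sum_(i < N) ((i.+1 + 3)%:R / 2 ^+ i.+1 : R) <= 5.
Proof.
suff: \sum_(i < N) ((i.+1 + 3)%:R / 2 ^+ i.+1 : R) = 5 - (N%:R + 5) / 2 ^+ N.
  by move=> ->; rewrite gerBl divr_ge0 ?exprn_ge0 ?addr_ge0.
elim: N => [|N IH]; first by rewrite big_ord0 expr0; field.
rewrite big_ord_recr /= IH [2 ^+ N.+1]exprS natrD.
by field; rewrite lt0r_neq0 // exprn_gt0.
Qed.

(** Here [1 + 105 * (2 * i + 3) <= 316 * (i + 2)] leads to the total [(316 * 16 + 5) / 2 ^ e], which
    is below [1 / 16] as soon as [e >= 17]. *)
Lemma sparse_sum e (n : nat -> nat) k : (17 <= e)%N ->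
  (forall j, (j <= J)%N -> 2 ^ e * n j <= (J - j).+1 * 2 ^ J)%N ->
  (forall j, (J < j)%N -> 2 ^ e * n j <= 2 ^ J)%N ->
  \sum_(j < (J + k).+1) (n j)%:R / 2 ^+ j * mean_code R J j <= 1 / 16.
Proof.
move=> e17 hl hh; have p0 (f : nat) : (0 : R) < 2 ^+ f by rewrite exprn_gt0.
rewrite -addSn big_split_ord /=.
have low : \sum_(j < J.+1) (n j)%:R / 2 ^+ j * mean_code R J j <= 316 * 16 / 2 ^+ e.
  rewrite (reindex_inj rev_ord_inj) /=.
  apply: (@le_trans _ _ (\sum_(i < J.+1) 316 / 2 ^+ e * ((i.+1 * i.+2)%:R / 2 ^+ i))).
    apply: ler_sum => i _; rewrite subSS.
    have iJ : (i <= J)%N by rewrite -ltnS.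
    rewrite /mean_code leq_subr subKn //.
    have := hl (J - i)%N (leq_subr _ _); rewrite subKn //; set m := n _ => hm.
    have {}hm : m%:R / 2 ^+ (J - i) <= i.+1%:R * 2 ^+ i / 2 ^+ e :> R.
      rewrite ler_pdivrMr // mulrAC ler_pdivlMr // -mulrA -exprD subnKC //.
      by rewrite -!natrX -!natrM ler_nat mulnC.
    have c4 : 4 ^+ i = 2 ^+ i * 2 ^+ i :> R by rewrite -exprMn; congr (_ ^+ _); ring.
    apply: (@le_trans _ _ (i.+1%:R * 2 ^+ i / 2 ^+ e *
       ((316 * i.+2%:R) / 4 ^+ i))).
      apply: ler_pM => //; rewrite ?divr_ge0 ?addr_ge0 ?mulr_ge0 ?exprn_ge0 //.
      rewrite ler_pM2r ?invr_gt0 ?exprn_gt0 // natrD natrM -[i.+2%:R]natr1 -[i.+1%:R]natr1.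
      by have : 0 <= i%:R :> R by []; lra.
    rewrite c4 natrM le_eqVlt; apply/orP; left; apply/eqP.
    by field; rewrite !lt0r_neq0.
  rewrite -mulr_sumr; have := sum_poly2_geo J.+1.
  have : 0 <= 316 / 2 ^+ e :> R by rewrite divr_ge0 // ltW.
  by move=> c0 /(ler_wpM2l c0); lra.
have high : \sum_(i < k) (n (J.+1 + i)%N)%:R / 2 ^+ (J.+1 + i) *
    mean_code R J (J.+1 + i) <= 5 / 2 ^+ e.
  apply: (@le_trans _ _ (\sum_(i < k) (2 ^+ e)^-1 * ((i.+1 + 3)%:R / 2 ^+ i.+1))).
    apply: ler_sum => i _; rewrite /mean_code leqNgt addSn ltnS leq_addr /=.
    rewrite -addnS addKn.
    have := hh (J + i.+1)%N; rewrite addnS ltnS leq_addr => /(_ isT).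
    rewrite -addnS; set m := n _ => hm.
    have {}hm : m%:R / 2 ^+ (J + i.+1) <= (2 ^+ e)^-1 / 2 ^+ i.+1 :> R.
      rewrite -invfM ler_pdivrMr // mulrC ler_pdivlMr ?mulr_gt0 //.
      by rewrite exprD mulrA ler_pM2r // mulrC -!natrX -natrM ler_nat.
    apply: (@le_trans _ _ ((2 ^+ e)^-1 / 2 ^+ i.+1 * (i.+1 + 3)%:R)).
      by rewrite ler_wpM2r.
    by rewrite -!mulrA [_^-1 * _%:R]mulrC.
  rewrite -mulr_sumr mulrC ler_pM2r ?invr_gt0 //; exact: sum_poly1_geo.
apply: le_trans (lerD low high) _; rewrite -mulrDl ler_pdivrMr //.
have : (2 : R) ^+ 17 <= 2 ^+ e by rewrite ler_eXn2l // ltr1n.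
have -> : (2 : R) ^+ 17 = 512 * 256 by ring.
lra.
Qed.

End Sums.

(** * Totients and orders of elements *)

Lemma totientMp p a : prime p -> (0 < a)%N ->
  totient (p * a) = ((if p %| a then p else p.-1) * totient a)%N.
Proof.
move=> pr a0; case: ifP => [pa|/negbT pa]; last first.
  by rewrite totient_coprime ?prime_coprime // totient_prime.
have [m cpm aE] := pfactor_coprime pr a0.
have e0 : (0 < logn p a)%N by rewrite -pfactor_dvdn ?expn1.
have cc e : coprime m (p ^ e) by rewrite coprime_sym coprimeXl.
rewrite aE mulnCA -expnS !totient_coprime ?cc // !totient_pfactor //=.
by rewrite -{1}(prednK e0) expnS; ring.
Qed.

(** Strip the primes of [b] one at a time: the factor gained is [p] or [p.-1], and it is [p] for
    [a * c] whenever it is for [c]. *)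
Lemma totient_supmul a b : (0 < a)%N -> (0 < b)%N ->
  (totient a * totient b <= totient (a * b))%N.
Proof.
move=> a0; have [k] := ubnP b; elim: k b => // k IH b ltbk b0.
have [b1|b1] := leqP b 1.
  by have -> : b = 1%N by [lia]; rewrite !muln1.
have [p pr /dvdnP[c bE]] : exists2 p, prime p & (p %| b)%N.
  by exists (pdiv b); [exact: pdiv_prime|exact: pdiv_dvd].
have p2 := prime_gt1 pr.
have c0 : (0 < c)%N by case: c bE b0 => // ->.
have ltck : (c < k)%N by move: ltbk; rewrite bE; nia.
have := IH c ltck c0.
rewrite bE [(c * p)%N]mulnC mulnCA (totientMp pr c0).
rewrite (totientMp pr (_ : 0 < a * c)%N) ?muln_gt0 ?a0 //.
have [pc|pc] := boolP (p %| c)%N.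
  by rewrite dvdn_mull // mulnCA leq_mul2l => ->; rewrite orbT.
move=> h; apply: (@leq_trans (p.-1 * totient (a * c))).
  by rewrite mulnCA leq_mul2l h orbT.
by rewrite leq_mul2r; case: ifP; rewrite ?leq_pred ?leqnn orbT.
Qed.

(** * Sums of reciprocals of totients *)

Section Harmonic.
Variable R : realFieldType.

(** This is [sigma(g) / g]; it replaces [g / phi(g)] up to a factor 2 and is easily averaged over
    [g]. *)
Definition inv_div_sum g : R := \sum_(d <- divisors g) d%:R^-1.

Lemma ler_sum_sub_uniq (I : eqType) (s1 s2 : seq I) (f : I -> R) :
  (forall x, 0 <= f x) -> uniq s1 -> uniq s2 -> {subset s1 <= s2} ->
  \sum_(x <- s1) f x <= \sum_(x <- s2) f x.
Proof.
move=> f0 u1 u2 s12; rewrite [leRHS](bigID (mem s1)) /= -[leLHS]addr0.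
apply: lerD; last exact: sumr_ge0.
rewrite -[leRHS]big_filter le_eqVlt; apply/orP; left; apply/eqP.
apply/perm_big/uniq_perm => //; first exact: filter_uniq.
by move=> x; rewrite mem_filter /=; have := s12 x; case: (x \in s1) => //= ->.
Qed.

(** The divisors [d] of [h] and the products [p * d] are distinct divisors of [h * p ^ e]. *)
Lemma inv_div_sumMp p e h : prime p -> (0 < e)%N -> (0 < h)%N -> coprime p h ->
  (1 + p%:R^-1) * inv_div_sum h <= inv_div_sum (h * p ^ e).
Proof.
move=> pr e0 h0 cph; have p0 := prime_gt0 pr.
rewrite mulrDl mul1r mulr_sumr.
have -> : \sum_(d <- divisors h) p%:R^-1 * d%:R^-1 =
    \sum_(d <- [seq (p * d)%N | d <- divisors h]) d%:R^-1 :> R.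
  by rewrite big_map; apply: eq_bigr => d _; rewrite natrM invfM.
rewrite -big_cat /=; apply: ler_sum_sub_uniq => [x|||x].
- by rewrite invr_ge0.
- rewrite cat_uniq divisors_uniq map_inj_uniq ?divisors_uniq ?andbT; last first.
    by move=> x y /eqP; rewrite eqn_pmul2l // => /eqP.
  apply/hasPn => x /mapP[d dh ->]; rewrite /= -dvdn_divisors //.
  apply/negP => /(dvdn_trans (dvdn_mulr _ (dvdnn p))).
  by apply/negP; rewrite -prime_coprime.
- exact: divisors_uniq.
have hp0 : (0 < h * p ^ e)%N by rewrite muln_gt0 h0 expn_gt0 p0.
rewrite mem_cat -!dvdn_divisors // => /orP[dh|/mapP[d dh ->]].
  exact: dvdn_mulr.
rewrite -dvdn_divisors // in dh; rewrite mulnC dvdn_mul //.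
by rewrite -{1}(expn1 p) dvdn_exp2l.
Qed.

(* The factor [1 + 1 / P] makes the product of [1 - 1 / p ^ 2] over the primes
   [p <= P] telescope. *)
Lemma totient_inv_div_sum_primes P g : (0 < g)%N ->
  (forall p, p \in primes g -> (p <= P.+1)%N) ->
  g%:R * (1 + P.+1%:R^-1) <= 2 * (totient g)%:R * inv_div_sum g.
Proof.
elim: P g => [|P IH] g g0 hp.
  have -> : g = 1%N.
    apply/eqP; rewrite eqn_leq g0 andbT leqNgt; apply/negP => g1.
    have := hp (pdiv g); rewrite mem_primes pdiv_prime // g0 pdiv_dvd => /(_ isT).
    by have := prime_gt1 (pdiv_prime g1); lia.
  by rewrite /inv_div_sum (_ : divisors 1 = [:: 1%N]) // big_seq1 invr1 (_ : totient 1 = 1%N) //; lra.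
set p := P.+2.
have p0 : (0 : R) < p%:R by rewrite ltr0n.
have [pg|pg] := boolP (p \in primes g); last first.
  apply: le_trans (IH g g0 _).
    apply: ler_wpM2l => //; rewrite lerD2l lef_pV2 ?posrE ?ltr0n //.
    by rewrite ler_nat.
  move=> q qg; have := hp q qg; rewrite leq_eqVlt => /orP[/eqP qE|//].
  by rewrite -/p in qE; rewrite -qE qg in pg.
move: (pg); rewrite mem_primes => /and3P[pr _ dpg].
have [h cph gE] := pfactor_coprime pr g0.
set e := logn p g in gE.
have e0 : (0 < e)%N by rewrite -pfactor_dvdn ?expn1.
have h0 : (0 < h)%N by case: h gE g0 {cph} => // ->.
have ch : coprime h (p ^ e) by rewrite coprime_sym coprimeXl.
have hph : forall q, q \in primes h -> (q <= P.+1)%N.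
  move=> q; rewrite mem_primes => /and3P[qr _ qh].
  have : (q <= p)%N.
    by apply: hp; rewrite mem_primes qr g0 gE dvdn_mulr.
  rewrite leq_eqVlt => /orP[/eqP qE|//].
  by move: cph; rewrite prime_coprime // -qE qh.
have {IH} := IH h h0 hph.
have := inv_div_sumMp pr e0 h0 cph; rewrite -gE.
have -> : totient g = (totient h * (P.+1 * p ^ e.-1))%N.
  by rewrite gE totient_coprime // totient_pfactor.
set s := inv_div_sum g; set t := inv_div_sum h => st ht.
have -> : g%:R = h%:R * (p%:R * p%:R ^+ e.-1) :> R.
  by rewrite gE natrM -exprS prednK // natrX.
rewrite !natrM natrX; set w : R := p%:R ^+ _.
have w0 : 0 < w by rewrite exprn_gt0.
have pP : p%:R = P.+1%:R + 1 :> R by rewrite natr1.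
have P0 : (0 : R) < P.+1%:R by rewrite ltr0n.
move: st ht p0; rewrite {}pP; move: P.+1%:R P0 => x x0 st ht px.
set f : R := (totient h)%:R in ht *; have f0 : 0 <= f by rewrite ler0n.
apply: (@le_trans _ _ (2 * (f * (x * w)) * ((1 + (x + 1)^-1) * t))); last first.
  by apply: ler_wpM2l => //; rewrite !mulr_ge0 // ltW.
have c0 : 0 <= x * w * (1 + (x + 1)^-1).
  by rewrite !mulr_ge0 ?addr_ge0 ?invr_ge0 ?ltW.
have := ler_wpM2l c0 ht.
have -> : 2 * (f * (x * w)) * ((1 + (x + 1)^-1) * t) =
  x * w * (1 + (x + 1)^-1) * (2 * f * t) by ring.
apply: le_trans; rewrite le_eqVlt; apply/orP; left; apply/eqP.
by field; rewrite !lt0r_neq0.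
Qed.

Lemma inv_totient_le g : (0 < g)%N ->
  (totient g)%:R^-1 <= 2 * inv_div_sum g / g%:R :> R.
Proof.
move=> g0; have t0 : (0 : R) < (totient g)%:R by rewrite ltr0n totient_gt0.
have gR : (0 : R) < g%:R by rewrite ltr0n.
have h : g%:R <= 2 * (totient g)%:R * inv_div_sum g.
  apply: le_trans (@totient_inv_div_sum_primes g g g0 _).
    by rewrite mulrDr mulr1 lerDl divr_ge0.
  by move=> p; rewrite mem_primes g0 => /and3P[_ _ /(dvdn_leq g0)/leqW].
rewrite -div1r ler_pdivrMr // mulrAC ler_pdivlMr // mul1r.
by apply: le_trans h _; rewrite mulrAC.
Qed.

Lemma sum_inv_multiples d N : (0 < d)%N ->
  \sum_(1 <= g < N.+1 | (d %| g)%N) g%:R^-1 =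
  d%:R^-1 * \sum_(1 <= k < (N %/ d).+1) k%:R^-1 :> R.
Proof.
move=> d0; elim: N => [|N IH]; first by rewrite div0n !big_geq // mulr0.
rewrite big_mkcond big_nat_recr //= -big_mkcond IH divnS //.
case: ifP => [dN|_]; last by rewrite addr0.
rewrite add1n [in RHS]big_nat_recr //= mulrDr; congr (_ + _).
by rewrite -invfM -natrM -[(N %/ d).+1]add1n -[1%N]/(nat_of_bool true) -dN -divnS // mulnC divnK.
Qed.

Lemma sum_inv_sqr_le N : \sum_(1 <= d < N.+1) (d%:R ^+ 2)^-1 <= 2 :> R.
Proof.
case: N => [|N]; first by rewrite big_geq.
suff: \sum_(1 <= d < N.+2) (d%:R ^+ 2)^-1 <= 2 - N.+1%:R^-1 :> R.
  by move/le_trans; apply; rewrite gerBl invr_ge0.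
elim: N => [|N IH]; first by rewrite big_nat1 expr1n invr1; lra.
rewrite big_nat_recr //=; apply: le_trans (lerD IH (lexx _)) _.
have -> : N.+2%:R = N.+1%:R + 1 :> R by rewrite natr1.
have : (0 : R) < N.+1%:R by rewrite ltr0n.
move: N.+1%:R => x x0.
suff : ((x + 1) ^+ 2)^-1 <= x^-1 - (x + 1)^-1 by lra.
have x1 : 0 < x + 1 by lra.
have -> : x^-1 - (x + 1)^-1 = (x * (x + 1))^-1 by field; rewrite !lt0r_neq0.
by rewrite lef_pV2 ?posrE ?mulr_gt0 ?exprn_gt0 // expr2 ler_wpM2r //; lra.
Qed.

(** Bound [1 / phi(g)] by [2 / g] times the sum of [1 / d] over [d] dividing [g], and exchange the
    sums: the multiples of [d] contribute at most [1 / d ^ 2] times the harmonic sum. *)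
Lemma sum_inv_totient_le G :
  \sum_(1 <= g < G.+1) (totient g)%:R^-1 <=
  4 * \sum_(1 <= k < G.+1) k%:R^-1 :> R.
Proof.
pose H : R := \sum_(1 <= k < G.+1) k%:R^-1.
have H0 : 0 <= H by apply: sumr_ge0 => k _; rewrite invr_ge0.
suff le2 : \sum_(1 <= g < G.+1) inv_div_sum g / g%:R <= 2 * H.
  apply: (@le_trans _ _ (\sum_(1 <= g < G.+1) 2 * (inv_div_sum g / g%:R))).
    rewrite big_seq [leRHS]big_seq; apply: ler_sum => g.
    by rewrite mem_index_iota => /andP[g0 _]; rewrite mulrA inv_totient_le.
  by rewrite -mulr_sumr -/H; lra.
have -> : \sum_(1 <= g < G.+1) inv_div_sum g / g%:R =
  \sum_(1 <= g < G.+1) \sum_(1 <= d < G.+1 | (d %| g)%N) d%:R^-1 * g%:R^-1.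
  apply: eq_big_nat => g /andP[g0 gG]; rewrite /inv_div_sum mulr_suml.
  rewrite -[RHS]big_filter; apply/perm_big/uniq_perm.
  - exact: divisors_uniq.
  - by rewrite filter_uniq // iota_uniq.
  move=> d; rewrite -dvdn_divisors // mem_filter mem_index_iota.
  by case: (boolP (d %| g)%N) => //= dg; rewrite (dvdn_gt0 g0 dg) (leq_ltn_trans (dvdn_leq g0 dg)).
rewrite (exchange_big_dep_nat predT) //=.
apply: (@le_trans _ _ (\sum_(1 <= d < G.+1) (d%:R ^+ 2)^-1 * H)); last first.
  by rewrite -mulr_suml ler_wpM2r // sum_inv_sqr_le.
rewrite big_seq [leRHS]big_seq; apply: ler_sum => d.
rewrite mem_index_iota => /andP[d0 dG]; rewrite -mulr_sumr sum_inv_multiples //.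
rewrite mulrA -invfM -expr2; apply: ler_wpM2l; first by rewrite invr_ge0 exprn_ge0.
rewrite /H (big_cat_nat (isT : 1 <= (G %/ d).+1)%N (leq_div G d : (G %/ d).+1 <= G.+1)%N) /= lerDl.
by apply: sumr_ge0 => k _; rewrite invr_ge0.
Qed.

Lemma harmonic_lt_pow2 G k : (G < 2 ^ k)%N ->
  \sum_(1 <= i < G.+1) i%:R^-1 <= k%:R :> R.
Proof.
move=> Gk; apply: (@le_trans _ _ (\sum_(1 <= i < 2 ^ k) i%:R^-1)).
  rewrite (big_cat_nat (isT : 1 <= G.+1)%N Gk) /= lerDl.
  by apply: sumr_ge0 => i _; rewrite invr_ge0.
elim: k {Gk} => [|k IH]; first by rewrite big_geq.
have k1 : (1 <= 2 ^ k)%N by rewrite expn_gt0.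
have k2 : (2 ^ k <= 2 ^ k.+1)%N by rewrite leq_exp2l.
rewrite (big_cat_nat k1 k2) /= -[k.+1%:R]natr1; apply: lerD => //.
apply: (@le_trans _ _ (\sum_(2 ^ k <= i < 2 ^ k.+1) (2 ^ k)%:R^-1)).
  rewrite big_seq [leRHS]big_seq; apply: ler_sum => i.
  rewrite mem_index_iota => /andP[ki _].
  have p0 : (0 < 2 ^ k)%N by rewrite expn_gt0.
  by rewrite lef_pV2 ?posrE ?ltr0n ?ler_nat // (leq_trans p0 ki).
rewrite sumr_const_nat expnS mul2n -addnn addnK -[leLHS]mulr_natr mulVf //.
by rewrite pnatr_eq0 -lt0n expn_gt0.
Qed.

End Harmonic.

(** Dividing by [g] maps these [d] injectively to residues coprime to [n / g]. *)
Lemma card_gcd_le n g : (0 < n)%N -> (g %| n)%N ->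
  (#|[set d : 'I_n | gcdn n d == g]| <= totient (n %/ g))%N.
Proof.
move=> n0 gn; have g0 := dvdn_gt0 n0 gn.
set m := (n %/ g)%N; have nE : n = (m * g)%N by rewrite divnK.
have -> : totient m = size [seq e <- iota 0 m | coprime m e].
  rewrite totient_count_coprime size_filter -sum1_count [RHS]big_mkcond /index_iota subn0.
  by apply: eq_bigr => e _; case: coprime.
have gd (d : 'I_n) : d \in [set d : 'I_n | gcdn n d == g] -> d = (d %/ g * g)%N :> nat.
  by rewrite inE => /eqP <-; rewrite divnK // dvdn_gcdr.
rewrite cardE -(size_map (fun d : 'I_n => d %/ g)%N); apply: uniq_leq_size.
  rewrite map_inj_in_uniq ?enum_uniq // => d e; rewrite !mem_enum => dA eA de.
  by apply: val_inj; rewrite /= (gd d dA) (gd e eA) de.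
move=> x /mapP[d]; rewrite mem_enum => dA ->.
have := gd d dA; set e := (d %/ g)%N => dE.
rewrite mem_filter mem_iota add0n /=; apply/andP; split.
  move: dA; rewrite inE dE {1}nE -muln_gcdl -{2}[g]mul1n eqn_pmul2r //.
by rewrite -(ltn_pmul2r g0) -dE -nE.
Qed.

(** The order of [d] is at least [2 ^ j] exactly when its gcd with [n] is at most [G]. Sum
    [phi(n / g) <= phi(n) / phi(g)] over [g <= G]; the harmonic sum up to [G < 2 ^ k] is at most
    [k]. *)
Lemma card_order_ge_le n j k : (0 < n)%N -> (n < 2 ^ k * 2 ^ j)%N ->
  (#|[set d : 'I_n | 2 ^ j <= n %/ gcdn n d]| <= 4 * totient n * k)%N.
Proof.
move=> n0 nk; set G := (n %/ 2 ^ j)%N.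
have Gk : (G < 2 ^ k)%N by rewrite ltn_divLR // expn_gt0.
have t0 : (0 : rat) < (totient n)%:R by rewrite ltr0n totient_gt0.
rewrite -(@ler_nat rat) !natrM mulrAC.
apply: (@le_trans _ _ ((4 * \sum_(1 <= i < G.+1) i%:R^-1) * (totient n)%:R)); last first.
  by rewrite ler_pM2r // ler_pM2l // harmonic_lt_pow2.
apply: (@le_trans _ _ ((\sum_(1 <= g < G.+1) (totient g)%:R^-1) * (totient n)%:R)); last first.
  by rewrite ler_pM2r // sum_inv_totient_le.
apply: (@le_trans _ _ (\sum_(1 <= g < G.+1) #|[set d : 'I_n | gcdn n d == g]|%:R)).
  rewrite -natr_sum ler_nat -sum1_card.
  have E g : #|[set d : 'I_n | gcdn n d == g]| = (\sum_(d < n) (gcdn n d == g))%N.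
    rewrite -sum1_card [LHS]big_mkcond /=; apply: eq_bigr => d _.
    by rewrite inE; case: eqP.
  under [leqRHS]eq_bigr do rewrite E.
  rewrite exchange_big /= big_mkcond; apply: leq_sum => d _; rewrite inE.
  case: ifP => // dj; have gc0 : (0 < gcdn n d)%N by rewrite gcdn_gt0 n0.
  rewrite (bigD1_seq (gcdn n d)) ?iota_uniq //= ?eqxx ?leq_addr //.
  rewrite mem_index_iota gc0 ltnS leq_divRL ?expn_gt0 //.
  by rewrite mulnC -leq_divRL.
rewrite mulr_suml big_seq [leRHS]big_seq; apply: ler_sum => g.
rewrite mem_index_iota => /andP[g0 _].
have [gn|gn] := boolP (g %| n)%N; last first.
  rewrite (_ : [set _ | _] = set0) ?cards0 ?mulr_ge0 ?invr_ge0 ?ler0n //.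
  apply/setP => d; rewrite !inE; apply/negbTE; apply: contra gn => /eqP <-.
  exact: dvdn_gcdl.
apply: (@le_trans _ _ (totient (n %/ g))%:R); first by rewrite ler_nat card_gcd_le.
rewrite mulrC ler_pdivlMr ?ltr0n ?totient_gt0 // -natrM ler_nat.
rewrite -{2}(divnK gn); apply: totient_supmul => //.
by rewrite divn_gt0 // dvdn_leq.
Qed.

(** * Arithmetic progressions as intervals *)

Local Open Scope nat_scope.

Section Cosets.
Variables (n : nat) (d : 'I_n.+1).

Definition ord_step := n.+1 %/ gcdn n.+1 d.

Definition coset_pt c k : 'I_n.+1 := inZp (c + k * d).

(* [Z_(n+1)] listed coset by coset of the subgroup generated by [d], each coset
   in the order [c, c + d, c + 2 d, ...]. *)
Definition coset_seq : seq 'I_n.+1 :=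
  [seq coset_pt c k | c <- iota 0 (gcdn n.+1 d), k <- iota 0 ord_step].

Let g := gcdn n.+1 d.
Let g_gt0 : 0 < g. Proof. by rewrite gcdn_gt0. Qed.
Let nE : n.+1 = ord_step * g. Proof. by rewrite divnK ?dvdn_gcdl. Qed.
Let dE : nat_of_ord d = d %/ g * g. Proof. by rewrite divnK ?dvdn_gcdr. Qed.

(** Reduction modulo [g] recovers the coset [c]. Then [ord_step] divides [(k' - k) * (d / g)] and is
    coprime to [d / g]. *)
Lemma coset_pt_inj c k c' k' : c < g -> c' < g -> k < ord_step -> k' < ord_step ->
  coset_pt c k = coset_pt c' k' -> c = c' /\ k = k'.
Proof.
move=> cg cg' kN kN' /(congr1 val) /= e.
have cc : c = c'.
  have := congr1 (modn^~ g) e; rewrite /= !modn_dvdm ?dvdn_gcdl //.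
  rewrite dE !mulnA ![_ + _ * g]addnC !modnMDl.
  by rewrite !modn_small.
split=> //; subst c'; move/eqP: e; rewrite eqn_modDl.
have cop : coprime ord_step (d %/ g).
  by rewrite /coprime -(eqn_pmul2r g_gt0) mul1n muln_gcdl -nE -dE.
wlog le : k k' kN kN' / k <= k'.
  move=> w; case/orP: (leq_total k k') => le; first exact: w.
  by rewrite eq_sym => /(w _ _ kN' kN le) ->.
rewrite eq_sym eqn_mod_dvd ?leq_mul2r ?le ?orbT // -mulnBl.
rewrite {1}nE {1}dE mulnA dvdn_pmul2r // Gauss_dvdl // => dv.
have [|pos] := posnP (k' - k); first by lia.
by have := dvdn_leq pos dv; lia.
Qed.

Lemma coset_seq_uniq : uniq coset_seq.
Proof.
apply: allpairs_uniq; rewrite ?iota_uniq // => -[c k] [c' k'].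
move=> /allpairsP[[x y] /= [xi yi [-> ->]]] /allpairsP[[x' y'] /= [xi' yi' [-> ->]]].
move: xi yi xi' yi'; rewrite !mem_iota !add0n => xi yi xi' yi' e.
by have [-> ->] := coset_pt_inj xi xi' yi yi' e.
Qed.

(** The list has no repetition and [g * ord_step = n.+1] entries. *)
Lemma coset_pt_surj (a : 'I_n.+1) :
  exists c k, [/\ c < g, k < ord_step & a = coset_pt c k].
Proof.
have sz : #|coset_seq| = #|'I_n.+1|.
  by rewrite (card_uniqP coset_seq_uniq) size_allpairs !size_iota card_ord mulnC -nE.
have : a \in coset_seq.
  have /subset_cardP/(_ (subset_predT _)) E :
    #|coset_seq| = #|predT : pred 'I_n.+1| by rewrite sz.
  by rewrite E.
case/allpairsP=> -[c k] /= [ci ki ->]; exists c, k.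
by move: ci ki; rewrite !mem_iota.
Qed.

Lemma coset_pt_period c k : coset_pt c (ord_step + k) = coset_pt c k.
Proof.
apply: val_inj => /=; rewrite mulnDl addnCA.
have -> : ord_step * d = d %/ g * n.+1 by rewrite {1}dE mulnCA -nE.
by rewrite modnMDl.
Qed.

Lemma coset_map_infix c i s : c < g -> i + s <= ord_step ->
  infix [seq coset_pt c k | k <- iota i s] coset_seq.
Proof.
move=> cg is_le; rewrite /coset_seq -/g.
have -> : g = c + (1 + (g - c.+1)) by lia.
rewrite iotaD add0n allpairs_cat iotaD allpairs_cat /= cats0.
apply: infix_catl; apply: infix_catr.
have -> : ord_step = i + (s + (ord_step - (i + s))) by lia.
by rewrite iotaD add0n iotaD !map_cat infix_infix.
Qed.

Lemma ap_coset_seq (a : 'I_n.+1) l : l <= ord_step ->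
  exists y1 y2 : seq 'I_n.+1,
  [/\ infix y1 coset_seq /\ size y1 <= ord_step,
      infix y2 coset_seq /\ size y2 <= ord_step,
      uniq (y1 ++ y2) & ap n.+1 a d l =i y1 ++ y2].
Proof.
move=> lN; have [c [k0 [cg k0N aE]]] := coset_pt_surj a.
(* The number of terms past the end of the coset, 0 by truncation if there is no wrap. From
   [l <= ord_step] follows [r <= k0], so the wrapped part does not meet the first. *)
pose r := k0 + l - ord_step; pose s := l - r.
have sr : s + r = l by rewrite /s /r; lia.
exists [seq coset_pt c k | k <- iota k0 s], [seq coset_pt c k | k <- iota 0 r].
split.
- by rewrite size_map size_iota; split; [apply: coset_map_infix => //|]; rewrite /s /r; lia.
- by rewrite size_map size_iota; split; [apply: coset_map_infix => //|]; rewrite /r; lia.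
- rewrite -map_cat map_inj_in_uniq.
    rewrite cat_uniq !iota_uniq /= andbT; apply/hasPn => x; rewrite !mem_iota /r /s; lia.
  move=> x y; rewrite !mem_cat !mem_iota => hx hy e.
  have [||_ //] := coset_pt_inj cg cg _ _ e; move: hx hy; rewrite /r /s; lia.
move=> x.
have -> : [seq coset_pt c k | k <- iota k0 s] ++ [seq coset_pt c k | k <- iota 0 r] =
    [seq coset_pt c k | k <- iota k0 l].
  rewrite -sr iotaD map_cat; congr (_ ++ _).
  case: (posnP r) => [->//|r0].
  have -> : k0 + s = ord_step + 0 by move: r0; rewrite /s /r; lia.
  by rewrite iotaDl -map_comp; apply: eq_map => k /=; rewrite coset_pt_period.
rewrite inE; apply/existsP/mapP => [[k /eqP xk]|[k]].
  exists (k0 + k); first by rewrite mem_iota leq_addr ltn_add2l ltn_ord.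
  apply: val_inj; rewrite /= xk aE /= modnDml; congr (_ %% _); ring.
rewrite mem_iota => /andP[k1 k2] ->; have kl : k - k0 < l by lia.
exists (Ordinal kl); rewrite /= aE /= modnDml; apply/eqP; congr (_ %% _).
by rewrite -addnA -mulnDl subnKC.
Qed.

End Cosets.

(** * The discrepancy bound *)

Section Herdisc.
Variables (R : realType) (n e : nat).
Hypothesis e17 : 17 <= e.
Let phi := totient n.+1.
(** An integer version of the logarithm in the theorem, with [n.+1 < phi * 2 ^ L]. *)
Let L := (trunc_log 2 (n.+1 %/ phi)).+1.
(** Two of the powers of 2 absorb the 4 of [card_order_ge_le]; the other [e] provide the saving
    required by [sparse_sum]. *)
Let J := e.+2 + up_log 2 (phi * L).

Let phi_gt0 : 0 < phi. Proof. by rewrite totient_gt0. Qed.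

Let n_lt : n.+1 < phi * 2 ^ L.
Proof. by rewrite mulnC -ltn_divLR // trunc_log_ltn. Qed.

Let J_ge : 2 ^ e.+2 * (phi * L) <= 2 ^ J.
Proof. by rewrite /J expnD leq_mul2l up_logP ?orbT. Qed.

Let J_le : 2 ^ J <= 2 ^ e.+3 * (phi * L).
Proof.
rewrite /J expnD (expnS 2 e.+2) [2 * _]mulnC -mulnA leq_mul2l; apply/orP; right.
have pL : 0 < phi * L by rewrite muln_gt0 phi_gt0.
have [le1|gt1] := leqP (phi * L) 1.
  have -> : phi * L = 1 by lia.
  by rewrite up_log1.
have /andP[h _] := up_log_bounds (isT : 1 < 2) gt1.
have u0 : 0 < up_log 2 (phi * L) by rewrite up_log_gt0.
by rewrite -(prednK u0) expnS leq_mul2l ltnW.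
Qed.

Let phi_le : phi <= 2 ^ J.
Proof.
apply: leq_trans J_ge; rewrite mulnCA leq_pmulr // muln_gt0 expn_gt0 //.
Qed.

Local Open Scope ring_scope.

Lemma sparse_cosets :
  \sum_(j < (J + L).+1) #|[set d : 'I_n.+1 | (2 ^ j <= ord_step d)%N]|%:R / 2 ^+ j
    * mean_code R J j <= 1 / 16.
Proof.
apply: (@sparse_sum R J e (fun j => #|[set d : 'I_n.+1 | (2 ^ j <= ord_step d)%N]|) L e17).
  move=> j jJ.
  (* Thus [L + (J - j)] bounds the logarithm in the count; as [L >= 1], it is at most
     [(J - j).+1 * L]. *)
  have hn : (n.+1 < 2 ^ (L + (J - j)) * 2 ^ j)%N.
    apply: leq_trans n_lt _; rewrite -expnD -addnA subnK // addnC expnD.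
    by rewrite leq_mul2r phi_le orbT.
  have := card_order_ge_le (ltn0Sn n) hn; rewrite -/phi /ord_step.
  move: #|_| (J - j)%N => m i hm.
  apply: leq_trans (leq_mul (leqnn i.+1) J_ge).
  have -> : (2 ^ e.+2 = 2 ^ e * 4)%N by rewrite -[e.+2]addn2 expnD.
  rewrite mulnCA -mulnA leq_mul2l; apply/orP; right.
  apply: leq_trans hm _.
  have Li : (L + i <= i.+1 * L)%N by rewrite /L; nia.
  apply: leq_trans (leq_mul (leqnn (4 * phi)) Li) _.
  by rewrite leq_eqVlt; apply/orP; left; apply/eqP; ring.
move=> j jJ.
have hn : (n.+1 < 2 ^ L * 2 ^ j)%N.
  apply: leq_trans n_lt _; rewrite mulnC leq_mul2l (leq_trans phi_le) ?orbT //.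
  by rewrite leq_exp2l // ltnW.
have := card_order_ge_le (ltn0Sn n) hn; rewrite -/phi /ord_step.
move: #|_| => m hm; apply: leq_trans J_ge.
have -> : (2 ^ e.+2 = 2 ^ e * 4)%N by rewrite -[e.+2]addn2 expnD.
by rewrite -mulnA leq_mul2l mulnA hm orbT.
Qed.

(** A progression is a disjoint union of two intervals, hence [722 = 2 * 361]. *)
Lemma disc_AP_le (X : {set 'I_n.+1}) :
  (disc_AP X)%:R <= 722 * theta R ^+ (2 * J) * L.+1%:R :> R.
Proof.
have cT : (#|'I_n.+1| <= 2 ^ (J + L))%N.
  rewrite card_ord ltnW // (leq_trans n_lt) // expnD leq_mul2r phi_le orbT //.
have XU : (#|X| <= 2 ^ (J + L))%N by apply: leq_trans (max_card _) cT.
have [C hC] := colourable_all (@coset_seq_uniq n) cT sparse_cosets XU.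
set B := 1 + _ in hC.
have BB : B <= 361 * theta R ^+ (2 * J) * L.+1%:R by exact: gap_sum_le.
pose chi : {ffun 'I_n.+1 -> bool} := [ffun x => x \in C].
have dev (a d : 'I_n.+1) (l : 'I_n.+2) : ap_ok d l ->
    (absz (col_sum X (ap n.+1 a d l) chi))%:R <= 2 * B :> R.
  move=> ok; have [y1 [y2 [[i1 s1] [i2 s2] u12 apE]]] := ap_coset_seq a ok.
  rewrite natr_absz intr_norm.
  have -> : (col_sum X (ap n.+1 a d l) chi)%:~R =
      \sum_(x <- y1 | x \in X) sgn R C x + \sum_(x <- y2 | x \in X) sgn R C x.
    rewrite -big_cat /= /col_sum rmorph_sum /= big_mkcond /=.
    rewrite [RHS]big_mkcond (big_uniq _ u12) /= [RHS]big_mkcond /=.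
    apply: eq_bigr => x _; rewrite inE apE ffunE /sgn.
    by case: (x \in _ ++ _); case: (x \in X) => //=; case: (x \in C).
  apply: le_trans (ler_normD _ _) _.
  have := hC d y1 i1 s1; have := hC d y2 i2 s2; lra.
have max_le : (max_dev X chi)%:R <= 2 * B :> R.
  have B0 : 0 <= 2 * B.
    have B1 : 0 <= B by rewrite addr_ge0 // sumr_ge0 // => t _; rewrite mulr_ge0 ?gap_ge0.
    by lra.
  have mx (I : finType) (P : pred I) (F : I -> nat) :
      (forall i, P i -> (F i)%:R <= 2 * B) -> (\max_(i | P i) F i)%:R <= 2 * B :> R.
    move=> h; apply: (big_ind (fun m : nat => m%:R <= 2 * B)) => // a b ha hb.
    by rewrite /maxn; case: ifP.
  by apply: (mx) => a _; apply: (mx) => d _; apply: (mx) => l; exact: dev.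
apply: (@le_trans _ _ (max_dev X chi)%:R); last by lra.
by rewrite ler_nat /disc_AP; case: arg_minnP => // chi0 _; apply.
Qed.

(** Squaring turns [theta ^+ (2 * J)] into [2 ^+ J], which is of order [phi * L]; the other two
    factors [L] come from [L.+1 <= 2 * L]. *)
Lemma herdisc_AP_sqr_le :
  (herdisc_AP n.+1)%:R ^+ 2 <= 722 ^+ 2 * (2 ^+ e.+3 * 4) * phi%:R * L%:R ^+ 3 :> R.
Proof.
have L1 : 1 <= L%:R :> R by rewrite ler1n.
have w0 : 0 <= theta R ^+ (2 * J) by rewrite exprn_ge0 // ltW ?theta_gt0.
have w2 : (theta R ^+ (2 * J)) ^+ 2 = 2 ^+ J.
  by rewrite -exprM -(theta4 R) -exprM; congr (_ ^+ _); lia.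
have := disc_AP_le; move: (theta R ^+ (2 * J)) w0 w2 => w w0 w2 hX.
have hJ : w ^+ 2 <= 2 ^+ e.+3 * (phi%:R * L%:R).
  by rewrite w2 -!natrX -!natrM ler_nat.
have hL : L.+1%:R ^+ 2 <= (2 * L%:R) ^+ 2 :> R.
  by apply: lerXn2r; rewrite ?nnegrE ?mulr_ge0 // -[L.+1%:R]natr1; lra.
have bound_ge0 : 0 <= 722 * w * L.+1%:R by rewrite !mulr_ge0.
apply: (@le_trans _ _ ((722 * w * L.+1%:R) ^+ 2)).
  apply: lerXn2r; rewrite ?nnegrE //.
  apply: (big_ind (fun m : nat => m%:R <= 722 * w * L.+1%:R)) => //.
  by move=> a b ha hb; rewrite /maxn; case: ifP.
have -> : 722 ^+ 2 * (2 ^+ e.+3 * 4) * phi%:R * L%:R ^+ 3 =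
   722 ^+ 2 * ((2 ^+ e.+3 * (phi%:R * L%:R)) * (2 * L%:R) ^+ 2) :> R by ring.
have -> : (722 * w * L.+1%:R) ^+ 2 = 722 ^+ 2 * (w ^+ 2 * L.+1%:R ^+ 2) by ring.
by apply: ler_wpM2l; [exact: sqr_ge0|apply: ler_pM => //; exact: sqr_ge0].
Qed.

End Herdisc.

(* Transfer to the standard reals and natural logarithms *)
From mathcomp Require Import Rstruct.
From Stdlib Require Import Reals Lra.

Lemma herdisc_AP_sqr_INR : exists2 K : R, (0 < K)%R & forall n : nat, 0 < n ->
  (INR (herdisc_AP n) ^ 2 <= K * INR (totient n) *
     INR (trunc_log 2 (n %/ totient n)).+1 ^ 3)%R.
Proof.
(* The choice [e = 17] gives [2 ^ e.+3 = 2 ^ 20]. *)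
exists (722 ^ 2 * (2 ^ 20 * 4))%R; first by Lra.lra.
case=> // n _; apply/RleP.
have := @herdisc_AP_sqr_le R n 17 (leqnn 17).
by rewrite !RmultE !RpowE !IZRposE !INRE.
Qed.

(** From [2 ^ t <= n / phi] and [ln 2 > 1 / 2] follows [t <= 2 * ln (n / phi)]; the factor [exp 1]
    supplies the remaining 1. *)
Lemma succ_trunc_log_le n : 0 < n ->
  (INR (trunc_log 2 (n %/ totient n)).+1 <=
   2 * ln (exp 1 * INR n / INR (totient n)))%R.
Proof.
move=> n0; set phi := totient n; set t := trunc_log 2 _.
have phi0 : 0 < phi by rewrite totient_gt0.
have phiR : (0 < INR phi)%R by apply: lt_0_INR; apply/ssrnat.ltP.
have nR : (0 < INR n)%R by apply: lt_0_INR; apply/ssrnat.ltP.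
have phin : phi <= n.
  rewrite /phi totient_count_coprime -[leqRHS]subn0 -[leqRHS]muln1.
  rewrite -sum_nat_const_nat; apply: leq_sum => i _; exact: leq_b1.
have tn : expn 2 t * phi <= n.
  by rewrite -leq_divRL // trunc_logP // divn_gt0.
have pow : (2 ^ t <= INR n / INR phi)%R.
  apply: (Rmult_le_reg_r (INR phi)) => //.
  rewrite /Rdiv Rmult_assoc Rinv_l ?Rmult_1_r; last by Lra.lra.
  have -> : (2 ^ t)%R = INR (expn 2 t) by elim: (t) => //= k ->; rewrite expnS mult_INR.
  by rewrite -mult_INR; apply: le_INR; apply/ssrnat.leP.
have x0 : (0 < INR n / INR phi)%R by apply: Rdiv_lt_0_compat.
rewrite /Rdiv Rmult_assoc ln_mult ?ln_exp; [|exact: exp_pos|exact: x0].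
have l2 : (INR t * ln 2 <= ln (INR n / INR phi))%R.
  rewrite -ln_pow; last by Lra.lra.
  have [lt|->] := Rle_lt_or_eq_dec _ _ pow; last exact: Rle_refl.
  by apply/Rlt_le/ln_increasing => //; apply: pow_lt; Lra.lra.
have := pos_INR t; have := ln_lt_2; rewrite S_INR /Rdiv in l2 *; Lra.nra.
Qed.

Theorem theorem5p1 :
  exists c : R, (0 < c)%R /\
    forall n : nat, (0 < n)%N ->
      (INR (herdisc_AP n) <=
       c * sqrt (INR (totient n)) *
       Rpower (ln (exp 1 * INR n / INR (totient n))) (3 / 2))%R.
Proof.
have [K K0 hK] := herdisc_AP_sqr_INR.
have K8 : (0 < 8 * K)%R by Lra.lra.
(* The 8 is the cube of the 2 in [L <= 2 * Y]; squaring the goal turns the exponent [3 / 2] into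
   3. *)
exists (sqrt (8 * K)); split; first exact: sqrt_lt_R0.
move=> n n0; have := hK n n0; have := succ_trunc_log_le n0.
set Y := ln _; set L := INR _.+1; set h := INR (herdisc_AP n).
set phi := INR (totient n) => LY hL.
have L1 : (1 <= L)%R by rewrite /L S_INR; have := pos_INR (trunc_log 2 (n %/ totient n)); Lra.lra.
have Y0 : (0 < Y)%R by Lra.lra.
have phi0 : (0 <= phi)%R by exact: pos_INR.
apply: Rsqr_incr_0_var; last first.
  by apply: Rmult_le_pos; [apply: Rmult_le_pos; exact: sqrt_pos|apply: Rlt_le; exact: exp_pos].
rewrite !Rsqr_mult !Rsqr_sqrt //; last by Lra.lra.
have -> : Rsqr (Rpower Y (3 / 2)) = (Y ^ 3)%R.
  rewrite /Rsqr -Rpower_plus -Rpower_pow //; congr Rpower; rewrite /=; Lra.lra.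
rewrite Rsqr_pow2; apply: Rle_trans hL _.
have L3 : (L ^ 3 <= (2 * Y) ^ 3)%R by apply: pow_incr; Lra.lra.
have -> : (8 * K * phi * Y ^ 3)%R = (K * phi * (2 * Y) ^ 3)%R by ring.
by apply: Rmult_le_compat_l => //; apply: Rmult_le_pos => //; Lra.lra.
Qed.
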